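(* Fix $T>0$, real constants $A_F,B_F,A_L,B_L$ with $B_F\neq0$, constants $\sigma_F,\sigma_L,Q_F,R_F,Q_L,R_L,Q_{L,T}>0$, $\lambda_L\ge0$, and a continuous $F:[0,T]\to\mathbb{R}$. Let $a$ solve $\dot a_t=\tfrac{2B_F^2}{R_F}a_t^2-2A_Fa_t-\tfrac{Q_F}{2}$, $a_T=0$, put $f(t):=A_F-\tfrac{2B_F^2}{R_F}a_t$, $h(t):=Q_Fe^{\int_0^tf(u)\,\mathrm du}$, $k(t):=e^{-2\int_0^tf(u)\,\mathrm du}$, $c:=\tfrac{B_F^4\lambda_L}{\sigma_F^2R_F^2}$, $e_1=(1,0,0)^{\mathsf T}$, and $$\mathcal A(t)=\begin{bmatrix}A_L&0&0\\-h(t)&0&0\\0&k(t)&0\end{bmatrix},\ \mathcal B=B_Le_1,\ \mathcal Q(t)=\mathrm{diag}\Big\{\tfrac{Q_L}2,-c\,k(t),0\Big\},\ L_T=\begin{bmatrix}\tfrac{Q_{L,T}}2&0&0\\0&-c\int_0^Tk(s)\,\mathrm ds&c\\0&c&0\end{bmatrix},\ M_T=-Q_{L,T}F(T)e_1.$$ Consider the system $$\dot L_t+L_t\mathcal A(t)+\mathcal A(t)^{\mathsf T}L_t-\tfrac2{R_L}L_t\mathcal B\mathcal B^{\mathsf T}L_t+\mathcal Q(t)=0,\qquad \dot M_t+\mathcal A(t)^{\mathsf T}M_t-\tfrac2{R_L}L_t\mathcal B\mathcal B^{\mathsf T}M_t-Q_LF(t)e_1=0$$ for $L_t\in\mathbb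 S^{3\times3}$, $M_t\in\mathbb{R}^3$ with terminal values $L_T,M_T$. Define $$q:=\max\Big\{\Big|\tfrac{Q_L}2-|A_L|-\|h\|_\infty\Big|,\ (c+1)\|k\|_\infty\Big\},\quad \beta:=\max\Big\{\tfrac{2}{R_L}B_L^2+|A_L|,\ \|h\|_\infty,\ \|k\|_\infty\Big\},\quad y_0:=\max\Big\{\tfrac{Q_{L,T}}2,\ c(\|k\|_1+1)\Big\}.$$ If $$T<\frac1{\sqrt{\beta q}}\arctan\Big(\sqrt{\tfrac q\beta}\,\frac1{y_0}\Big),$$ then the system admits a unique solution on $[0,T]$.
   Context: $\|\cdot\|_\infty$ and $\|\cdot\|_1$ denote the sup norm and $L^1$ norm of functions on $[0,T]$. $\mathbb S^{3\times3}$ denotes symmetric $3\times3$ real matrices. *)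

(* Defs.v *)
From HB Require Import structures.
From mathcomp Require Import all_boot all_order all_algebra.
From mathcomp Require Import all_classical all_reals all_analysis.
Set Implicit Arguments. Unset Strict Implicit. Unset Printing Implicit Defensive.
Import Order.TTheory GRing.Theory Num.Theory.
Import numFieldNormedType.Exports.
Local Open Scope classical_set_scope.
Local Open Scope ring_scope.

Section Defs.
Variable R : realType.

Definition intl (f : R -> R) (a b : R) : R :=
  \int[lebesgue_measure]_(u in `[a, b]) f u.

Definition supnorm (T : R) (f : R -> R) : R := sup [set `|f t| | t in `[0, T]].
Definition L1norm (T : R) (f : R -> R) : R := intl (fun t => `|f t|) 0 T.

Definition mx3 (a11 a12 a13 a21 a22 a23 a31 a32 a33 : R) : 'M[R]_3 :=
  \matrix_(i < 3, j < 3)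
    nth 0 (nth [::] [:: [:: a11; a12; a13]; [:: a21; a22; a23]; [:: a31; a32; a33]] i) j.

Definition e1 : 'cV[R]_3 := delta_mx 0 0.

Definition ode_sol (V : normedModType R) (T : R) (x : R -> V)
    (E : R -> V -> V -> Prop) : Prop :=
  {within `[0, T], continuous x} /\
  forall t, 0 < t < T -> derivable x t 1 /\ E t (x t) (derive1 x t).

Definition fF (AF BF RF : R) (a : R -> R) (t : R) : R := AF - 2 * BF ^+ 2 / RF * a t.
Definition hF (AF BF RF QF : R) (a : R -> R) (t : R) : R :=
  QF * expR (intl (fF AF BF RF a) 0 t).
Definition kF (AF BF RF : R) (a : R -> R) (t : R) : R :=
  expR (- 2 * intl (fF AF BF RF a) 0 t).

Definition cstc (BF sigF RF lamL : R) : R := BF ^+ 4 * lamL / (sigF ^+ 2 * RF ^+ 2).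

Definition calA (AL : R) (h k : R -> R) (t : R) : 'M[R]_3 :=
  mx3 AL 0 0 (- h t) 0 0 0 (k t) 0.
Definition calB (BL : R) : 'cV[R]_3 := BL *: e1.
Definition calQ (QL c : R) (k : R -> R) (t : R) : 'M[R]_3 :=
  mx3 (QL / 2) 0 0 0 (- c * k t) 0 0 0 0.
Definition LTmx (QLT c T : R) (k : R -> R) : 'M[R]_3 :=
  mx3 (QLT / 2) 0 0 0 (- c * intl k 0 T) c 0 c 0.
Definition MTvec (QLT : R) (F : R -> R) (T : R) : 'cV[R]_3 := - (QLT * F T) *: e1.

Definition system_sol (T AL BL QL RL QLT c : R) (F h k : R -> R)
    (L : R -> 'M[R]_3) (M : R -> 'cV[R]_3) : Prop :=
  let A := calA AL h k in
  let B := calB BL in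
  (forall t, 0 <= t <= T -> (L t)^T = L t) /\
  ode_sol T L (fun t X dX =>
    dX + X *m A t + (A t)^T *m X - (2 / RL) *: (X *m B *m B^T *m X)
      + calQ QL c k t = 0) /\
  ode_sol T M (fun t Y dY =>
    dY + (A t)^T *m Y - (2 / RL) *: (L t *m B *m B^T *m Y)
      - (QL * F t) *: e1 = 0) /\
  L T = LTmx QLT c T k /\ M T = MTvec QLT F T.

End Defs.

(* Main.v *)
Require Import Defs.
From HB Require Import structures.
From mathcomp Require Import all_boot all_order all_algebra.
From mathcomp Require Import all_classical all_reals all_analysis.
From mathcomp Require Import perm ring lra.
Set Implicit Arguments. Unset Strict Implicit. Unset Printing Implicit Defensive.
Import Order.TTheory GRing.Theory Num.Theory.
Import numFieldNormedType.Exports.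
Local Open Scope classical_set_scope.
Local Open Scope ring_scope.

(** The Riccati equation for [L] is linearised by its Hamiltonian system
    [X' = A X - S Y], [Y' = - Q X - A^T Y], [X_T = 1], [Y_T = L_T], with
    [S = (2 / R_L) B B^T]: wherever [X] is invertible, [L = Y X^-1] is a solution.

    If [X_t0 xi = 0], put [p = X xi], [n = Y xi], [D = p_2 - p_2(T)] and
    [K_t = int_0^t k].  Then [n_3] is constant and
      [V = p.n - 2 c p_2(T) p_3 + c p_2(T)^2 K + phi p_1^2 - om D^2]
    satisfies [V' <= - eps p_1^2] as soon as, with [r = 2 B_L^2 / R_L] and
    [H = sup |h|], [phi' <= - (r phi^2 + 2 A_L phi + H - Q_L / 2)] and
    [om' >= c k + gam om^2] for some [gam > H].  As [V(t0) <= 0 <= V(T)], this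
    forces [p_1 = 0] and then [xi = 0], so [X] is invertible.

    The bound on [T] provides both barriers: it gives [sqrt (beta q) T < pi / 2], so
    [phi = sqrt (q / beta) tan (sqrt (beta q) (T - t))] is finite on [[0, T]], and,
    through [atan x <= x], [H c (K_T + 1) T < 1], so that
    [om = c K_t / (1 - H c (K_T + 1) t)] is finite on [[0, T]]. *)

(** * Real calculus: monotonicity from derivatives, and primitives of functions continuous on
    [[0, T]] *)

Section Calculus.
Variable R : realType.
Implicit Types (a b t x T : R) (f g D E : R -> R).

Lemma derive_le0_nincr f g a b : a <= b ->
  {within `[a, b], continuous f} ->
  (forall t, a < t < b -> is_derive t 1 f (g t)) ->
  (forall t, a < t < b -> g t <= 0) -> f b <= f a.
Proof.
rewrite le_eqVlt => /predU1P[-> //|ab] cf df g0.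
have dfI x : x \in `]a, b[ -> is_derive x 1 f (g x).
  by rewrite in_itv; exact: df.
have [x xab fE] := MVT ab dfI cf.
rewrite -subr_le0 fE; apply: mulr_le0_ge0; last by rewrite subr_ge0 ltW.
by apply: g0; rewrite in_itv in xab.
Qed.

Lemma is_derive_within f g a b :
  (forall t, a <= t <= b -> is_derive t 1 f (g t)) ->
  {within `[a, b], continuous f}.
Proof.
move=> df; apply: derivable_within_continuous => x; rewrite in_itv/=.
by move=> /df[].
Qed.

(** The hypothesis makes both [D + E] and [E - D] nonincreasing, so their nonnegativity at [b]
    passes back to [a]. Estimates run backward because the data are prescribed at [T]. *)
Lemma derive_dominated D E D' E' a b : a <= b ->
  {within `[a, b], continuous D} -> {within `[a, b], continuous E} ->
  (forall t, a < t < b -> is_derive t 1 D (D' t)) ->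
  (forall t, a < t < b -> is_derive t 1 E (E' t)) ->
  (forall t, a < t < b -> `|D' t| <= - E' t) ->
  `|D b| <= E b -> `|D a| <= E a.
Proof.
move=> ab cD cE dD dE DE; rewrite !ler_norml => /andP[Db1 Db2].
have H1 : (D + E) b <= (D + E) a.
  apply: (@derive_le0_nincr _ (fun t => D' t + E' t)) => //.
  - exact: within_continuousD.
  - by move=> t tab; apply: is_deriveD; [exact: dD|exact: dE].
  - by move=> t /DE; rewrite ler_norml => /andP[]; lra.
have H2 : (E - D) b <= (E - D) a.
  apply: (@derive_le0_nincr _ (fun t => E' t - D' t)) => //.
  - exact: within_continuousB.
  - by move=> t tab; apply: is_deriveB; [exact: dE|exact: dD].
  - by move=> t /DE; rewrite ler_norml => /andP[]; lra.
have {}H1 : D b + E b <= D a + E a := H1.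
have {}H2 : E b - D b <= E a - D a := H2.
by apply/andP; split; lra.
Qed.

Lemma derive0_const f a b : a <= b ->
  {within `[a, b], continuous f} ->
  (forall t, a < t < b -> is_derive t 1 f 0) -> f a = f b.
Proof.
move=> ab cf df; apply/eqP; rewrite -subr_eq0 -normr_le0.
apply: (@derive_dominated (fun x => f x - f b) (cst 0) (cst 0) (cst 0) a b) => //.
- by apply: within_continuousB => //; apply: continuous_subspaceT => x; exact: cvg_cst.
- by apply: continuous_subspaceT => x; exact: cvg_cst.
- move=> t /df H; rewrite -[cst 0 t]subr0.
  exact: is_deriveB.
- by move=> t _; rewrite normr0 oppr0.
- by rewrite subrr normr0.
Qed.

Lemma within_bounded f a b : a <= b -> {within `[a, b], continuous f} ->
  exists2 M, 0 <= M & forall t, a <= t <= b -> `|f t| <= M.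
Proof.
move=> ab cf; have [|c _ cM] := @EVT_max R (fun x => `|f x|) a b ab.
  by move=> x; apply: cvg_norm; exact: cf.
by exists `|f c| => // t tab; apply: cM; rewrite in_itv.
Qed.

(** For [0 <= T], the projection of the line onto [[0, T]]. Precomposing with it turns continuity on
    the subspace [[0, T]] into continuity on the whole line, without changing the values on
    [[0, T]]. *)
Definition clamp T x : R := Num.max 0 (Num.min x T).

Lemma clampE T x : 0 <= x <= T -> clamp T x = x.
Proof.
by move=> /andP[x0 xT]; rewrite /clamp (min_idPl xT) (max_idPr x0).
Qed.

Lemma clamp_itv T x : 0 <= T -> 0 <= clamp T x <= T.
Proof. by move=> T0; rewrite /clamp le_max lexx/= ge_max T0 ge_min lexx orbT. Qed.

Lemma continuous_clamp T : continuous (clamp T).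
Proof.
move=> x; rewrite (_ : clamp T = (cst 0 \max (id \min cst T))%O)//.
apply: continuous_max; first exact: cvg_cst.
by apply: continuous_min; [exact: cvg_id|exact: cvg_cst].
Qed.

Lemma continuous_comp_clamp T f : 0 <= T ->
  {within `[0, T], continuous f} -> continuous (f \o clamp T).
Proof.
move=> T0 cf x; apply: (@cvg_comp _ _ _ (clamp T) f (nbhs x)
  (within `[0, T] (nbhs (clamp T x)))).
(* Since [clamp T] only takes values in [[0, T]], the filter at [x] is pushed into the trace on
   [[0, T]] of the filter at [clamp T x]. *)
- move=> A; rewrite /within/= => wA.
  have H := @continuous_clamp T x _ wA.
  apply: (@filterS _ (nbhs x) _
    [set y | clamp T y \in `[0, T] -> A (clamp T y)]) H => y /=.
  by apply; rewrite in_itv/= clamp_itv.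
- by move/subspace_continuousP: cf; apply; rewrite /= in_itv/= clamp_itv.
Qed.

(* The lower bound -1 makes [prim f] differentiable at 0 as well. *)
Definition prim f x : R := intl f (-1) x.

Lemma is_derive_prim f x : continuous f -> -1 < x -> is_derive x 1 (prim f) (f x).
Proof.
move=> cf x1.
have fi : (@lebesgue_measure R).-integrable `[-1, x + 1] (EFin \o f).
  apply: continuous_compact_integrable; first exact: segment_compact.
  exact: continuous_subspaceT.
have xx1 : x < x + 1 by rewrite ltrDl.
have [d e] : derivable (prim f) x 1 /\ derive1 (prim f) x = f x.
  exact: (continuous_FTC1_closed xx1 fi x1 (cf x)).
by apply: DeriveDef; [exact: d|rewrite -derive1E; exact: e].
Qed.

(** Trades the integral for a primitive of the clamped function, which has a two-sided derivative at
    0 and at [T]. The fundamental theorem is applied on a nondegenerate interval, hence the separate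
    case [t = 0]. *)
Lemma intlE f T t : {within `[0, T], continuous f} -> 0 <= t <= T ->
  intl f 0 t = prim (f \o clamp T) t - prim (f \o clamp T) 0.
Proof.
move=> cf /andP[]; rewrite le_eqVlt => /predU1P[<-|t0] tT.
  by rewrite subrr /intl set_itv1 Rintegral_set1.
have T0 : 0 <= T by rewrite (le_trans _ tT)// ltW.
have cc := continuous_comp_clamp T0 cf.
rewrite /intl /Rintegral (@continuous_FTC2 R f (prim (f \o clamp T)) 0 t) //.
- by apply: continuous_subspaceW cf; apply: subset_itvl; rewrite bnd_simp.
- have d x : -1 < x -> derivable (prim (f \o clamp T)) x 1.
    by move=> /(is_derive_prim cc)[].
  have cp x : -1 < x -> {for x, continuous (prim (f \o clamp T))}.
    by move=> /d/derivable1_diffP/differentiable_continuous.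
  split.
  + by move=> x; rewrite in_itv/= => /andP[x0 _]; apply: d; lra.
  + by apply: cvg_at_right_filter; apply: cp; lra.
  + by apply: cvg_at_left_filter; apply: cp; lra.
- move=> x; rewrite in_itv/= => /andP[x0 xt]; rewrite derive1E.
  have [|_ ->] := @is_derive_prim (f \o clamp T) x cc; first lra.
  by rewrite /= clampE// (ltW x0) (le_trans (ltW xt)).
Qed.

End Calculus.

(** * Linear systems *)

Section LinearODE.
Variable R : realType.

Lemma cvg_sumr (X : Type) (J : finType) (F : set_system X) (FF : Filter F)
    (f : J -> X -> R) (l : J -> R) :
  (forall j, f j x @[x --> F] --> l j) ->
  \sum_j f j x @[x --> F] --> \sum_j l j.
Proof.
move=> fl; apply: cvg_big => [|j _]; last exact: fl.
by move=> x; exact: add_continuous.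
Qed.
Variables (I : finType) (T : R) (G : I -> I -> R -> R) (b : I -> R -> R) (z0 : I -> R).
Hypothesis T0 : 0 <= T.
Hypothesis cG : forall i j, continuous (G i j).
Hypothesis cb : forall i, continuous (b i).
Implicit Types (z w : I -> R -> R) (i j : I) (t s a e K C M : R).

Let rhs (z : I -> R -> R) i t : R := \sum_j G i j t * z j t + b i t.

(** The Picard operator of a terminal value problem: the difference of primitives is the oriented
    integral of [rhs z i] from [T] to [t]. *)
Let picard (z : I -> R -> R) i t : R :=
  z0 i + (prim (rhs z i) t - prim (rhs z i) T).

Let continuous_rhs z : (forall i, continuous (z i)) -> forall i, continuous (rhs z i).
Proof.
move=> cz i x; apply: cvgD; last exact: cb.
by apply: cvg_sumr => j; apply: cvgM; [exact: cG|exact: cz].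
Qed.

Let is_derive_picard z i t : (forall i, continuous (z i)) -> -1 < t ->
  is_derive t 1 (picard z i) (rhs z i t).
Proof.
move=> cz t1; rewrite -[rhs z i t]add0r -[rhs z i t]subr0.
apply: is_deriveD; apply: is_deriveB.
by apply: is_derive_prim => //; exact: continuous_rhs.
Qed.

Let picardT z i : picard z i T = z0 i.
Proof. by rewrite /picard subrr addr0. Qed.

Let within_picard z i a : -1 < a -> (forall i, continuous (z i)) ->
  {within `[a, T], continuous (picard z i)}.
Proof.
move=> a1 cz; apply: (@is_derive_within _ _ (rhs z i)) => t /andP[ta _].
by apply: is_derive_picard => //; exact: lt_le_trans ta.
Qed.

(** Clamping each iterate makes it continuous on the whole line, as [is_derive_prim] asks of the
    next integrand, and makes bounds on [[0, T]] global. *)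
Let zn := fix zn n : I -> R -> R :=
  if n is m.+1 then fun i => picard (zn m) i \o clamp T else fun _ => cst 0.

Let continuous_zn n i : continuous (zn n i).
Proof.
elim: n i => [|n IH] i /=; first by move=> x; exact: cvg_cst.
by apply: continuous_comp_clamp => //; apply: within_picard => //; rewrite ltrN10.
Qed.

Let zn_clamp n i t : zn n i (clamp T t) = zn n i t.
Proof. by case: n => //= n; rewrite (@clampE _ T (clamp T t)) ?clamp_itv. Qed.

Let G_bounded : exists2 K : R, 0 < K & forall i t, 0 <= t <= T -> \sum_j `|G i j t| <= K.
Proof.
have /choice[M HM] : forall i, exists M, 0 <= M /\ forall t, 0 <= t <= T -> \sum_j `|G i j t| <= M.
  move=> i; have [|M M0 HM] := @within_bounded _ (fun t => \sum_j `|G i j t|) 0 T T0.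
    apply: continuous_subspaceT => x; apply: cvg_sumr => j.
    by apply: cvg_norm; exact: cG.
  by exists M; split => // t /HM; apply: le_trans; exact: ler_norm.
(* The sum dominates each [M i]; the added 1 keeps the bound positive when [G] vanishes or [I] is
   empty. *)
exists (1 + \sum_i M i).
  by apply: ltr_wpDr => //; apply: sumr_ge0 => i _; exact: (HM i).1.
move=> i t /(HM i).2 /le_trans; apply; rewrite (bigD1 i)//=.
have : 0 <= \sum_(j | j != i) M j by apply: sumr_ge0 => j _; exact: (HM j).1.
by set S := \sum_(_ | _) _; lra.
Qed.

Let rhs_dist K z w e i t : (forall i t, 0 <= t <= T -> \sum_j `|G i j t| <= K) ->
  0 <= t <= T -> (forall j, `|z j t - w j t| <= e) -> `|rhs z i t - rhs w i t| <= K * e.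
Proof.
move=> HK tT zw; have -> : rhs z i t - rhs w i t = \sum_j G i j t * (z j t - w j t).
  rewrite /rhs opprD addrACA subrr addr0 -sumrB.
  by apply: eq_bigr => j _; rewrite mulrBr.
apply: (le_trans (ler_norm_sum _ _ _)).
apply: (@le_trans _ _ (\sum_j `|G i j t| * e)).
  by apply: ler_sum => j _; rewrite normrM ler_wpM2l.
rewrite -mulr_suml ler_wpM2r ?HK//.
(* What is left is [0 <= e], which the hypothesis gives at any index; [i] shows that there is
   one. *)
have [j _|I0] := pickP (fun j : I => true); first exact: le_trans (zw j).
by have := I0 i.
Qed.

(* The weight [expR (2 K (T - t))] makes the Picard operator a contraction of
   ratio 1/2 on the whole of [[0, T]]. *)
Let zn_cauchy : exists2 C : R, 0 <= C & forall n i t, `|zn n.+1 i t - zn n i t| <= C * 2^-1 ^+ n.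
Proof.
have [K K0 HK] := G_bounded.
have /choice[M HM] : forall i, exists M, 0 <= M /\ forall t, 0 <= t <= T -> `|zn 1 i t| <= M.
  move=> i; have [|M M0 HM] := @within_bounded _ (zn 1 i) 0 T T0; last by exists M.
  by apply: continuous_subspaceT; exact: continuous_zn.
pose B := \sum_i M i.
have B0 : 0 <= B by apply: sumr_ge0 => i _; exact: (HM i).1.
have MB i : M i <= B.
  rewrite /B (bigD1 i)//= lerDl; apply: sumr_ge0 => j _; exact: (HM j).1.
pose E n t : R := B * 2^-1 ^+ n * expR (2 * K * (T - t)).
(* Differentiating the weight brings out [- 2 K], and [2 E (n+1) = E n]; the decay rate of [E n.+1]
   is therefore [K * E n], the Lipschitz bound on [rhs]. *)
have dE n t : is_derive t 1 (E n.+1) (- (K * E n t)).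
  have -> : - (K * E n t) =
      B * 2^-1 ^+ n.+1 * (expR (2 * K * (T - t)) * (2 * K * (0 - 1))).
    by rewrite /E exprS; field.
  apply: is_deriveZ.
have H : forall n i t, 0 <= t <= T -> `|zn n.+1 i t - zn n i t| <= E n t.
  elim=> [|n IH] i t tT.
    rewrite {2}/zn subr0 /E expr0 mulr1 (le_trans ((HM i).2 _ tT))//.
    rewrite (le_trans (MB i))// ler_peMr// -expR0 ler_expR.
    by rewrite mulr_ge0 ?subr_ge0 ?mulr_ge0 ?(ltW K0)//; case/andP: tT.
  have -> : zn n.+2 i t = picard (zn n.+1) i t by rewrite /= clampE.
  have -> : zn n.+1 i t = picard (zn n) i t by rewrite /= clampE.
  have /andP[t0 tT'] := tT.
  have t1 : -1 < t by lra.
  apply: (@derive_dominated _ (fun s => picard (zn n.+1) i s - picard (zn n) i s) (E n.+1)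
     (fun s => rhs (zn n.+1) i s - rhs (zn n) i s) (fun s => - (K * E n s)) t T) => //.
  - by apply: within_continuousB; apply: within_picard.
  - by apply: is_derive_within => s _; exact: dE.
  - move=> s /andP[ts _].
    by apply: is_deriveB; apply: is_derive_picard => //; lra.
  - move=> s /andP[ts sT]; rewrite opprK; apply: rhs_dist => //.
      by apply/andP; split; lra.
    by move=> j; apply: IH; apply/andP; split; lra.
  - rewrite !picardT subrr normr0.
    by rewrite /E !mulr_ge0 ?expR_ge0 ?exprn_ge0.
exists (B * expR (2 * K * T)); first by rewrite mulr_ge0 ?expR_ge0.
move=> n i t; rewrite -zn_clamp -(zn_clamp n) (le_trans (H _ _ _ (clamp_itv _ T0)))//.
rewrite /E mulrAC ler_wpM2r ?exprn_ge0// ler_wpM2l// ler_expR ler_pM2l ?mulr_gt0//.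
by rewrite gerBl; have /andP[] := clamp_itv t T0.
Qed.

Let half_pow_small (C e : R) : 0 < e -> exists n, C * 2^-1 ^+ n <= e.
Proof.
move=> e0; have [C0|C0] := leP C 0.
  by exists 0%N; rewrite expr0 mulr1 (le_trans C0)// ltW.
have : (GRing.exp (2^-1 : R)) @ \oo --> 0.
  by apply: cvg_expr; rewrite ger0_norm ?invr_ge0// invf_lt1 ?ltr1n.
move/cvgrPdist_le => /(_ (e / C)) []; first by rewrite divr_gt0.
move=> n _ /(_ n (leqnn n)); rewrite sub0r normrN ger0_norm ?exprn_ge0// => H.
by exists n; rewrite mulrC -ler_pdivlMr.
Qed.

Let zn_limit : exists C : R, exists z : I -> R -> R,
  forall n i t, `|z i t - zn n i t| <= C * 2^-1 ^+ n.
Proof.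
have [C C0 HC] := zn_cauchy.
(* The tail of the geometric series with terms [C / 2^m], [m >= n]. *)
pose e n : R := 2 * C * 2^-1 ^+ n.
have e0 n : 0 <= e n by rewrite !mulr_ge0 ?exprn_ge0.
have eS n : e n = e n.+1 + C * 2^-1 ^+ n by rewrite /e exprS; field.
have mono i t m n : zn n i t - e n <= zn (m + n) i t - e (m + n)%N
    /\ zn (m + n) i t + e (m + n)%N <= zn n i t + e n.
  elim: m => [|m [IH1 IH2]]//; rewrite addSn.
  have := HC (m + n)%N i t; rewrite ler_norml => /andP[]; move: IH1 IH2.
  by have := eS (m + n)%N; split; lra.
have le i t m n : zn n i t - e n <= zn m i t + e m.
  have [nm|/ltnW mn] := leqP n m.
    by have [+ _] := mono i t (m - n)%N n; rewrite subnK//; have := e0 m; lra.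
  by have [_ +] := mono i t (n - m)%N m; rewrite subnK//; have := e0 n; lra.
(* [zn n - e n] increases and [zn n + e n] decreases in [n]: any real between
   the two sequences is a limit of [zn n]. *)
exists (2 * C), (fun i t => sup (range (fun n => zn n i t - e n))) => n i t.
rewrite -/(e n) ler_distl; apply/andP; split.
- apply: ub_le_sup; last by exists n.
  by exists (zn 0%N i t + e 0%N) => _ [m _ <-].
- apply: ge_sup; first by exists (zn 0%N i t - e 0%N); exists 0%N.
  by move=> _ [m _ <-].
Qed.

(** The limit of the iterates is continuous by uniform convergence and is a fixed point of [picard]
    on [[0, T]]. The witness is [picard z] and not [z]: being a primitive, it is differentiable at
    the endpoints, where the clamped [z] may have a corner. *)
Lemma linear_ode_continuous : exists z : I -> R -> R,
  (forall i, z i T = z0 i) /\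
  forall i t, 0 <= t <= T -> is_derive t 1 (z i) (\sum_j G i j t * z j t + b i t).
Proof.
have [K K0 HK] := G_bounded.
have [C [z Hz]] := zn_limit.
have cz i : continuous (z i).
  move=> x; apply/cvgrPdist_le => e e0.
  have e3 : 0 < e / 3 by rewrite divr_gt0.
  have [n Hn] := half_pow_small C e3.
  have /cvgrPdist_le/(_ _ e3) := @continuous_zn n i x.
  apply: filterS => y H.
  have := le_trans (Hz n i x) Hn; have := le_trans (Hz n i y) Hn; move: H.
  by rewrite !ler_norml => /andP[? ?] /andP[? ?] /andP[? ?]; apply/andP; split; lra.
have zE i t : 0 <= t <= T -> picard z i t = z i t.
  move=> tT; have /andP[t0 tT'] := tT.
  apply/eqP; rewrite -subr_eq0 -normr_le0; apply/ler_addgt0Pr => e e0; rewrite add0r.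
  (* The first part bounds [picard z - zn n.+1] through the distance from [z] to [zn n], integrated
     over a length at most [T]; the second is the distance from [zn n.+1] to [z]. *)
  have [n Hn] := half_pow_small (K * T * C + C * 2^-1) e0.
  apply: le_trans Hn.
  have D1 : `|picard z i t - zn n.+1 i t| <= K * T * C * 2^-1 ^+ n.
    have -> : zn n.+1 i t = picard (zn n) i t by rewrite /= clampE.
    apply: (@le_trans _ _ (K * C * 2^-1 ^+ n * (T - t))); last first.
      have : 0 <= K * C * 2^-1 ^+ n * t.
        rewrite mulr_ge0// -mulrA mulr_ge0 ?(ltW K0)//.
        exact: le_trans (Hz n i t).
      lra.
    have dl s : is_derive s 1 (fun s => K * C * 2^-1 ^+ n * (T - s))
                  (K * C * 2^-1 ^+ n * (0 - 1)).
      have dT : is_derive s 1 (fun s => T - s) (0 - 1) by exact: is_deriveB.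
      exact: (@is_deriveZ _ _ _ (fun s => T - s) (K * C * 2^-1 ^+ n) s 1 _ dT).
    apply: (@derive_dominated _ (fun s => picard z i s - picard (zn n) i s)
      (fun s => K * C * 2^-1 ^+ n * (T - s))
      (fun s => rhs z i s - rhs (zn n) i s) (fun s => K * C * 2^-1 ^+ n * (0 - 1)) t T) => //.
    - by apply: within_continuousB; apply: within_picard => //; lra.
    - by apply: is_derive_within => s _; exact: dl.
    - by move=> s /andP[ts _]; apply: is_deriveB; apply: is_derive_picard => //; lra.
    - move=> s /andP[ts sT]; rewrite sub0r mulrN1 opprK -mulrA; apply: rhs_dist => //.
      by apply/andP; split; lra.
    - by rewrite !picardT !subrr normr0 mulr0.
  have D2 := Hz n.+1 i t; rewrite distrC exprS in D2.
  by have := lerD D1 D2 => /(le_trans (ler_distD _ _ _)) /le_trans; apply; lra.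
exists (picard z); split; first by move=> i; exact: picardT.
move=> i t tT.
have -> : \sum_j G i j t * picard z j t + b i t = rhs z i t.
  by congr (_ + _); apply: eq_bigr => j _; rewrite zE.
by apply: is_derive_picard => //; have /andP[] := tT; lra.
Qed.

End LinearODE.

(** * Matrix-valued functions *)

Section MatrixCalculus.
Variable R : realType.
Implicit Types (a b t T : R).

Lemma is_derive_sumr (J : finType) (f : J -> R -> R) (df : J -> R) t :
  (forall j, is_derive t 1 (f j) (df j)) ->
  is_derive t 1 (fun s => \sum_j f j s) (\sum_j df j).
Proof.
move=> dfj; elim: (index_enum J) => [|j s IH].
  rewrite big_nil (_ : (fun _ => _) = cst 0); first exact: is_derive_cst.
  by apply/funext => x; rewrite big_nil.
rewrite big_cons (_ : (fun _ => _) = (f j + fun u => \sum_(i <- s) f i u)).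
  exact: is_deriveD.
by apply/funext => x; rewrite big_cons.
Qed.

Lemma derivable_prodr (J : finType) (f : J -> R -> R) t :
  (forall j, derivable (f j) t 1) -> derivable (fun s => \prod_j f j s) t 1.
Proof.
move=> dfj; elim: (index_enum J) => [|j s IH].
  rewrite (_ : (fun _ => _) = cst 1); first exact: derivable_cst.
  by apply/funext => x; rewrite big_nil.
rewrite (_ : (fun _ => _) = (f j * fun u => \prod_(i <- s) f i u)).
  exact: derivableM.
by apply/funext => x; rewrite big_cons.
Qed.

Lemma is_derive_mxP m n (M : R -> 'M[R]_(m, n)) (dM : 'M[R]_(m, n)) t :
  is_derive t 1 M dM <-> forall i j, is_derive t 1 (fun s => M s i j) (dM i j).
Proof.
split=> [[dMt eM] i j|H].
  have /derivable_mxP/(_ i j) d := dMt.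
  by apply: DeriveDef => //; rewrite -eM derive_mx// mxE.
have d : derivable M t 1 by apply/derivable_mxP => i j; case: (H i j).
apply: DeriveDef => //; rewrite derive_mx//; apply/matrixP => i j.
by rewrite mxE; case: (H i j).
Qed.

Lemma is_derive_mulmx m n p (M : R -> 'M[R]_(m, n)) (N : R -> 'M[R]_(n, p)) dM dN t :
  is_derive t 1 M dM -> is_derive t 1 N dN ->
  is_derive t 1 (fun s => M s *m N s) (dM *m N t + M t *m dN).
Proof.
move=> /is_derive_mxP HM /is_derive_mxP HN; apply/is_derive_mxP => i j.
rewrite (_ : (fun _ => _) = fun s => \sum_k M s i k * N s k j); last first.
  by apply/funext => s; rewrite mxE.
rewrite !mxE -big_split/=; apply: is_derive_sumr => k.
have -> : dM i k * N t k j + M t i k * dN k j = M t i k *: dN k j + N t k j *: dM i k.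
  by rewrite /GRing.scale/= addrC [X in _ + X]mulrC.
exact: is_deriveM.
Qed.

Lemma is_derive_mulmx_cst m n p (M : R -> 'M[R]_(m, n)) (N : 'M[R]_(n, p)) dM t :
  is_derive t 1 M dM -> is_derive t 1 (fun s => M s *m N) (dM *m N).
Proof.
move=> HM; have := is_derive_mulmx HM (@is_derive_cst _ _ _ N t 1).
by rewrite mulmx0 addr0.
Qed.

Lemma derivable_scalemx m n (f : R -> R) (M : R -> 'M[R]_(m, n)) t :
  derivable f t 1 -> derivable M t 1 -> derivable (fun s => f s *: M s) t 1.
Proof.
move=> df /derivable_mxP HM; apply/derivable_mxP => i j.
rewrite (_ : (fun _ => _) = f * (fun s => M s i j)); first exact: derivableM.
by apply/funext => s; rewrite !mxE.
Qed.

Lemma derivable_det n (M : R -> 'M[R]_n) t :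
  derivable M t 1 -> derivable (fun s => \det (M s)) t 1.
Proof.
move=> /derivable_mxP dM.
have H (s : 'S_n) : derivable (fun x => (-1) ^+ s * \prod_i M x i (s i)) t 1.
  by apply: derivableM; [exact: derivable_cst|exact: derivable_prodr].
have [] // := @is_derive_sumr _ (fun (s : 'S_n) x => (-1) ^+ s * \prod_i M x i (s i))
  (fun s => 'D_1 (fun x => (-1) ^+ s * \prod_i M x i (s i)) t) t.
Qed.

Lemma derivable_adj n (M : R -> 'M[R]_n) t :
  derivable M t 1 -> derivable (fun s => \adj (M s)) t 1.
Proof.
move=> /derivable_mxP dM; apply/derivable_mxP => i j.
rewrite (_ : (fun _ => _) = cst ((-1) ^+ (j + i)%N) * (fun s => \det (row' j (col' i (M s))))).
  apply: derivableM; first exact: derivable_cst.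
  apply: derivable_det; apply/derivable_mxP => k l.
  rewrite (_ : (fun _ => _) = fun s => M s (lift j k) (lift i l)) //.
  by apply/funext => s; rewrite !mxE.
by apply/funext => s; rewrite !mxE.
Qed.

(** Near [t] the determinant does not vanish, so the inverse is the adjugate over the determinant
    and is differentiable; its derivative is then read off from [M *m invmx M = 1]. *)
Lemma is_derive_invmx n (M : R -> 'M[R]_n) dM t :
  is_derive t 1 M dM -> M t \in unitmx ->
  is_derive t 1 (fun s => invmx (M s)) (- (invmx (M t) *m dM *m invmx (M t))).
Proof.
move=> HM ut; have dMt : derivable M t 1 by case: HM.
have uM : \forall s \near t, M s \in unitmx.
  have cd : {for t, continuous (fun s => \det (M s))}.
    by apply/differentiable_continuous/derivable1_diffP; exact: derivable_det.
  have := cvgr_neq0 _ cd; rewrite -unitfE -unitmxE => /(_ _ ut).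
  by apply: filterS => s; rewrite unitmxE unitfE.
have dI : derivable (fun s => invmx (M s)) t 1.
  apply: (@near_eq_derivable _ _ _ (fun s => (\det (M s))^-1 *: \adj (M s))).
    by near=> s; rewrite /invmx ifT//; near: s.
  apply: derivable_scalemx; last exact: derivable_adj.
  by apply: derivableV; [rewrite -unitfE -unitmxE|exact: derivable_det].
have HI := derivableP dI.
have H := is_derive_mulmx HM HI.
have H0 : is_derive t 1 (fun s => M s *m invmx (M s)) 0.
  have Hc : is_derive t 1 (fun=> 1%:M : 'M[R]_n) 0 by exact: is_derive_cst.
  apply: near_eq_is_derive Hc.
  by near=> s; rewrite mulmxV//; near: s.
have E : dM *m invmx (M t) + M t *m 'D_1 (fun s => invmx (M s)) t = 0.
  by case: H H0 => _ <- [].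
suff -> : - (invmx (M t) *m dM *m invmx (M t)) = 'D_1 (fun s => invmx (M s)) t by [].
rewrite -mulmxA -mulmxN.
have -> : - (dM *m invmx (M t)) = M t *m 'D_1 (fun s => invmx (M s)) t.
  by apply/eqP; rewrite eq_sym -subr_eq0 opprK addrC E.
by rewrite mulmxA mulVmx// mul1mx.
Unshelve. all: by end_near. Qed.

Lemma within_mxP m n (A : set R) (M : R -> 'M[R]_(m, n)) :
  {within A, continuous M} <-> forall i j, {within A, continuous (fun s => M s i j)}.
Proof.
split=> [cM i j x|cM x].
  by apply: (@cvg_comp _ _ _ M (fun X : 'M[R]_(m, n) => X i j)
    (nbhs (x : subspace A)) (nbhs (M x))); [exact: cM|exact: coord_continuous].
apply/cvgrPdist_le => e e0.
near=> y.
rewrite /Num.Def.normr/= mx_normrE (bigmax_le _ (ltW e0))//= => ij _.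
rewrite !mxE; move: ij; near: y; apply: filter_forall => ij.
by have /cvgrPdist_le := cM ij.1 ij.2 x; apply.
Unshelve. all: by end_near. Qed.

(** Cauchy-Schwarz against the constant 1, from [f j * f k <= (f j ^+ 2 + f k ^+ 2) / 2] summed over
    all pairs. *)
Lemma sqr_sum_le (J : finType) (f : J -> R) :
  (\sum_j f j) ^+ 2 <= #|J|%:R * \sum_j f j ^+ 2.
Proof.
have -> : (\sum_j f j) ^+ 2 = \sum_j \sum_k f j * f k.
  by rewrite expr2 mulr_suml; apply: eq_bigr => j _; rewrite mulr_sumr.
have -> : #|J|%:R * \sum_j f j ^+ 2 = \sum_j \sum_k (f j ^+ 2 + f k ^+ 2) / 2.
  under [RHS]eq_bigr => j _ do rewrite -mulr_suml big_split/= sumr_const.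
  rewrite -mulr_suml big_split/= sumr_const sumrMnl.
  by set S := \sum_(_ | _) _; rewrite -[S *+ _]mulr_natl; field.
apply: ler_sum => j _; apply: ler_sum => k _.
by have := sqr_ge0 (f j - f k); nra.
Qed.

(** The sum of squares [w] inherits differentiability from the [d j] and satisfies [w' >= - K w].
    Hence [w * expR (K t)] is nondecreasing; as it vanishes at [T], the nonnegative [w] vanishes
    before [T]. *)
Lemma gronwall_backward (J : finType) (d d' : J -> R -> R) (C T : R) : 0 <= C ->
  (forall j, {within `[0, T], continuous (d j)}) ->
  (forall j t, 0 < t < T -> is_derive t 1 (d j) (d' j t)) ->
  (forall j t, 0 < t < T -> `|d' j t| <= C * \sum_k `|d k t|) ->
  (forall j, d j T = 0) -> forall j t, 0 <= t <= T -> d j t = 0.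
Proof.
move=> C0 cd dd dC dT j t /andP[t0 tT].
pose w s : R := \sum_k d k s * d k s.
pose w' s : R := \sum_k (d k s *: d' k s + d k s *: d' k s).
pose K := 2 * C * #|J|%:R.
have dw s : 0 < s < T -> is_derive s 1 w (w' s).
  by move=> sT; apply: is_derive_sumr => k; apply: is_deriveM; exact: dd.
have w0 s : 0 <= w s by apply: sumr_ge0 => k _; rewrite -expr2 sqr_ge0.
have w'K s : 0 < s < T -> - (K * w s) <= w' s.
  move=> sT; rewrite lerNl; apply: le_trans (ler_norm _) _; rewrite normrN.
  apply: le_trans (ler_norm_sum _ _ _) _.
  apply: (@le_trans _ _ (\sum_k 2 * C * ((\sum_l `|d l s|) * `|d k s|))).
    apply: ler_sum => k _.
    rewrite -mulr2n normrMn /GRing.scale/= normrM -mulr_natl.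
    have := dC k s sT; have : 0 <= `|d k s| by []; nra.
  rewrite -mulr_sumr -mulr_sumr -expr2 /K -[leRHS]mulrA ler_wpM2l ?mulr_ge0//.
  apply: le_trans (sqr_sum_le _) _; rewrite ler_wpM2l//.
  by apply: ler_sum => k _; rewrite real_normK ?num_real// expr2.
have wt : w t * expR (K * t) <= 0.
  have wT : w T * expR (K * T) = 0.
    by rewrite /w big1 ?mul0r// => k _; rewrite dT mul0r.
  rewrite -oppr_ge0 -[X in X <= _]oppr0 -{1}wT.
  have dE (s : R) : is_derive s 1 (fun s => expR (K * s)) (expR (K * s) * (K *: 1)).
    exact: (@is_derive1_comp _ expR (fun s => K * s)).
  apply: (@derive_le0_nincr _ (fun s => - (w s * expR (K * s)))
    (fun s => - (w s *: (expR (K * s) * (K *: 1)) + expR (K * s) *: w' s))) => //.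
  - move=> x; apply: cvgN; apply: cvgM.
      apply: cvg_sumr => k.
      have ck : {within `[t, T], continuous (d k)}.
        by apply: continuous_subspaceW (cd k); apply: subset_itvr; rewrite bnd_simp.
      by apply: cvgM; exact: ck.
    have cE : {within `[t, T], continuous (fun s : R => expR (K * s))}.
      by apply: is_derive_within => s _; exact: dE.
    exact: cE.
  - move=> s /andP[ts sT]; apply: is_deriveN; apply: is_deriveM.
    by apply: dw; apply/andP; split; lra.
  - move=> s /andP[ts sT]; rewrite oppr_le0 /GRing.scale/= mulr1.
    have := w'K s; have -> : 0 < s < T by apply/andP; split; lra.
    by move=> /(_ isT); have := expR_gt0 (K * s); nra.
have {}wt : w t = 0.
  apply/eqP; rewrite eq_le w0 andbT.
  by move: wt; rewrite pmulr_lle0 ?expR_gt0.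
move/eqP: wt; rewrite psumr_eq0; last by move=> k _; rewrite -expr2 sqr_ge0.
by move=> /allP/(_ j (mem_index_enum j))/=; rewrite mulf_eq0 orbb => /eqP.
Qed.

(** The entrywise sum norm is submultiplicative, which the entrywise maximum is not, and it matches
    the sum in [gronwall_backward]. *)
Definition mx_l1 m n (M : 'M[R]_(m, n)) : R := \sum_i \sum_j `|M i j|.

Lemma mx_l1_ge0 m n (M : 'M[R]_(m, n)) : 0 <= mx_l1 M.
Proof. by apply: sumr_ge0 => i _; apply: sumr_ge0. Qed.

Lemma mx_l1D m n (M N : 'M[R]_(m, n)) : mx_l1 (M + N) <= mx_l1 M + mx_l1 N.
Proof.
rewrite /mx_l1 -big_split/=; apply: ler_sum => i _; rewrite -big_split/=.
by apply: ler_sum => j _; rewrite mxE ler_normD.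
Qed.

Lemma mx_l1N m n (M : 'M[R]_(m, n)) : mx_l1 (- M) = mx_l1 M.
Proof. by apply: eq_bigr => i _; apply: eq_bigr => j _; rewrite mxE normrN. Qed.

Lemma mx_l1M m n p (M : 'M[R]_(m, n)) (N : 'M[R]_(n, p)) :
  mx_l1 (M *m N) <= mx_l1 M * mx_l1 N.
Proof.
rewrite /mx_l1 mulr_suml; apply: ler_sum => i _.
apply: (@le_trans _ _ (\sum_k \sum_j `|M i k| * `|N k j|)).
  rewrite exchange_big/=; apply: ler_sum => j _; rewrite mxE.
  apply: le_trans (ler_norm_sum _ _ _) _.
  by apply: ler_sum => k _; rewrite normrM.
rewrite mulr_suml; apply: ler_sum => k _; rewrite -mulr_sumr ler_wpM2l//.
rewrite [leRHS](bigD1 k)//= lerDl.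
by apply: sumr_ge0 => l _; apply: sumr_ge0.
Qed.

Lemma within_mx_bounded m n (M : R -> 'M[R]_(m, n)) T : 0 <= T ->
  {within `[0, T], continuous M} ->
  exists2 C, 0 <= C & forall t, 0 <= t <= T -> mx_l1 (M t) <= C.
Proof.
move=> T0 /within_mxP cM.
have [|C C0 HC] := @within_bounded _ (fun t => mx_l1 (M t)) 0 T T0.
  move=> x; apply: cvg_sumr => i; apply: cvg_sumr => j.
  by apply: cvg_norm; exact: cM.
by exists C => // t /HC; apply: le_trans; exact: ler_norm.
Qed.

Lemma gronwall_mx m n (D D' : R -> 'M[R]_(m, n)) (C T : R) : 0 <= C ->
  {within `[0, T], continuous D} ->
  (forall t, 0 < t < T -> is_derive t 1 D (D' t)) ->
  (forall t, 0 < t < T -> mx_l1 (D' t) <= C * mx_l1 (D t)) ->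
  D T = 0 -> forall t, 0 <= t <= T -> D t = 0.
Proof.
move=> C0 /within_mxP cD dD DC DT t tT; apply/matrixP => i j; rewrite mxE.
apply: (@gronwall_backward ('I_m * 'I_n)%type (fun p s => D s p.1 p.2)
  (fun p s => D' s p.1 p.2) C T C0 _ _ _ _ (i, j)) => //.
- by move=> p s /dD /is_derive_mxP.
- move=> p s sT; have := DC s sT; rewrite /mx_l1 !pair_bigA/=; apply: le_trans.
  by rewrite (bigD1 p)//= lerDl; apply: sumr_ge0.
- by move=> p; rewrite DT mxE.
Qed.

(** The columns of [Z] decouple into vector systems with the common coefficient [G]. Clamping
    extends [G] and [b] from [[0, T]] to the line. *)
Lemma linear_ode_mx n m (G : R -> 'M[R]_n) (b : R -> 'M[R]_(n, m)) (Z0 : 'M[R]_(n, m)) T :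
  0 <= T -> {within `[0, T], continuous G} -> {within `[0, T], continuous b} ->
  exists Z : R -> 'M[R]_(n, m), Z T = Z0 /\
    forall t, 0 <= t <= T -> is_derive t 1 Z (G t *m Z t + b t).
Proof.
move=> T0 /within_mxP cG /within_mxP cb.
have /choice[z Hz] : forall j : 'I_m, exists z : 'I_n -> R -> R,
  (forall i, z i T = Z0 i j) /\ forall i t, 0 <= t <= T ->
    is_derive t 1 (z i) (\sum_k (((fun s => G s i k) \o clamp T) t) * z k t
       + ((fun s => b s i j) \o clamp T) t).
  move=> j; apply: linear_ode_continuous => //.
    by move=> i k; exact: (continuous_comp_clamp T0 (cG i k)).
  by move=> i; exact: (continuous_comp_clamp T0 (cb i j)).
exists (fun t => \matrix_(i, j) z j i t); split.
  by apply/matrixP => i j; rewrite mxE (Hz j).1.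
move=> t tT; apply/is_derive_mxP => i j; rewrite !mxE.
rewrite (_ : (fun _ => _) = z j i); last by apply/funext => s; rewrite mxE.
have := (Hz j).2 i t tT; rewrite /= clampE//.
by under [in X in _ -> X]eq_bigr => k _ do rewrite mxE.
Qed.

End MatrixCalculus.

(** * The Lyapunov function *)

Section Lyapunov.
Variable R : realType.

(** In the derivative of [p.n] the cross terms cancel and [- r n1^2 - QL / 2 p1^2 + c k p2^2]
    remains. The terms [- 2 c x2 p3] and [c x2^2 Kt] recentre [c k p2^2] at [x2 = p2 T], so that the
    [om] term can absorb it; they also cancel the indefinite part of the terminal value. *)
Lemma hamiltonian_energy (T r mu QL QLT c t0 : R)
    (h k Kt phi dphi om dom p1 p2 p3 n1 n2 n3 : R -> R) :
  (forall t, t0 <= t <= T -> is_derive t 1 Kt (k t)) ->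
  (forall t, t0 <= t <= T -> is_derive t 1 phi (dphi t)) ->
  (forall t, t0 <= t <= T -> is_derive t 1 om (dom t)) ->
  (forall t, t0 <= t <= T -> is_derive t 1 p1 (mu * p1 t - r * n1 t)) ->
  (forall t, t0 <= t <= T -> is_derive t 1 p2 (- h t * p1 t)) ->
  (forall t, t0 <= t <= T -> is_derive t 1 p3 (k t * p2 t)) ->
  (forall t, t0 <= t <= T ->
     is_derive t 1 n1 (- mu * n1 t + h t * n2 t - QL / 2 * p1 t)) ->
  (forall t, t0 <= t <= T -> is_derive t 1 n2 (- k t * n3 t + c * k t * p2 t)) ->
  (forall t, t0 <= t <= T -> is_derive t 1 n3 0) ->
  (forall t, t0 <= t <= T -> n3 t = c * p2 T) ->
  n1 T = QLT / 2 * p1 T -> n2 T = - c * Kt T * p2 T + c * p3 T ->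
  n3 T = c * p2 T ->
  p1 t0 = 0 -> p2 t0 = 0 -> p3 t0 = 0 ->
  exists V : R -> R, [/\
    forall t, t0 <= t <= T -> is_derive t 1 V
      (- r * n1 t ^+ 2 - QL / 2 * p1 t ^+ 2 + c * k t * (p2 t - p2 T) ^+ 2
       + dphi t * p1 t ^+ 2 + 2 * phi t * p1 t * (mu * p1 t - r * n1 t)
       - dom t * (p2 t - p2 T) ^+ 2 + 2 * om t * (p2 t - p2 T) * h t * p1 t),
    V T = QLT / 2 * p1 T ^+ 2 + phi T * p1 T ^+ 2 &
    V t0 = (c * Kt t0 - om t0) * p2 T ^+ 2].
Proof.
move=> dKt dphi' dom' dp1 dp2 dp3 dn1 dn2 dn3 n3E n1T n2T n3T p10 p20 p30.
pose x2 := p2 T.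
pose V t : R := p1 t * n1 t + p2 t * n2 t + p3 t * n3 t - 2 * c * x2 * p3 t
  + c * x2 ^+ 2 * Kt t + phi t * (p1 t * p1 t)
  - om t * ((p2 t - x2) * (p2 t - x2)).
exists V; split; last 2 first.
- by rewrite /V n1T n2T n3T /x2; ring.
- by rewrite /V p10 p20 p30 /x2; ring.
move=> t tT.
have dD : is_derive t 1 (p2 - cst x2) (- h t * p1 t - 0).
  by apply: is_deriveB; exact: dp2.
have d1 := is_deriveM (dp1 t tT) (dn1 t tT).
have d2 := is_deriveM (dp2 t tT) (dn2 t tT).
have d3 := is_deriveM (dp3 t tT) (dn3 t tT).
have d4 := is_deriveZ (2 * c * x2) (dp3 t tT).
have d5 := is_deriveZ (c * x2 ^+ 2) (dKt t tT).
have d6 := is_deriveM (dphi' t tT) (is_deriveM (dp1 t tT) (dp1 t tT)).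
have d7 := is_deriveM (dom' t tT) (is_deriveM dD dD).
have d := is_deriveB (is_deriveD (is_deriveD (is_deriveB
  (is_deriveD (is_deriveD d1 d2) d3) d4) d5) d6) d7.
have {}d : is_derive t 1 V _ := d.
apply: (is_derive_eq d).
have DE : (p2 - cst x2) t = p2 t - x2 by [].
have PE : (p1 * p1) t = p1 t * p1 t by [].
have PE2 : ((p2 - cst x2) * (p2 - cst x2)) t = (p2 t - x2) * (p2 t - x2) by [].
rewrite /GRing.scale/= PE PE2 DE n3E// -/x2.
by ring.
Qed.

(** [V] is nonincreasing with [V t0 <= 0 <= V T], hence identically 0. Its decay rate [eps p1^2]
    then forces [p1 = 0], and the triangular equations for [p2] and [p3], started from 0, carry the
    vanishing to [T]. *)
Lemma hamiltonian_kernel_trivial (T r mu QL QLT c H gam t0 : R)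
    (h k Kt phi dphi om dom p1 p2 p3 n1 n2 n3 : R -> R) :
  0 <= r -> 0 < QLT -> 0 < H < gam -> t0 <= T ->
  (forall t, t0 <= t <= T -> `|h t| <= H) ->
  (forall t, t0 <= t <= T -> is_derive t 1 Kt (k t)) ->
  (forall t, t0 <= t <= T -> is_derive t 1 phi (dphi t)) ->
  (forall t, t0 <= t <= T -> is_derive t 1 om (dom t)) ->
  (forall t, t0 <= t <= T ->
     dphi t + r * phi t ^+ 2 + 2 * mu * phi t + H - QL / 2 <= 0) ->
  (forall t, t0 <= t <= T -> c * k t + gam * om t ^+ 2 <= dom t) ->
  0 <= phi T -> c * Kt t0 <= om t0 ->
  (forall t, t0 <= t <= T -> is_derive t 1 p1 (mu * p1 t - r * n1 t)) ->
  (forall t, t0 <= t <= T -> is_derive t 1 p2 (- h t * p1 t)) ->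
  (forall t, t0 <= t <= T -> is_derive t 1 p3 (k t * p2 t)) ->
  (forall t, t0 <= t <= T ->
     is_derive t 1 n1 (- mu * n1 t + h t * n2 t - QL / 2 * p1 t)) ->
  (forall t, t0 <= t <= T -> is_derive t 1 n2 (- k t * n3 t + c * k t * p2 t)) ->
  (forall t, t0 <= t <= T -> is_derive t 1 n3 0) ->
  n1 T = QLT / 2 * p1 T -> n2 T = - c * Kt T * p2 T + c * p3 T ->
  n3 T = c * p2 T ->
  p1 t0 = 0 -> p2 t0 = 0 -> p3 t0 = 0 ->
  [/\ p1 T = 0, p2 T = 0 & p3 T = 0].
Proof.
move=> r0 QLT0 /andP[H0 Hgam] t0T hH dKt dphi' dom' phiR omR phiT omt0.
move=> dp1 dp2 dp3 dn1 dn2 dn3 n1T n2T n3T p10 p20 p30.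
pose x2 := p2 T.
have n3E t : t0 <= t <= T -> n3 t = c * x2.
  move=> /andP[tt0 tT]; rewrite -n3T; apply: derive0_const => //.
    apply: (@is_derive_within _ _ (cst 0)) => s /andP[ts sT].
    by apply: dn3; rewrite sT (le_trans tt0).
  by move=> s /andP[ts sT]; apply: dn3; rewrite (ltW sT) (le_trans tt0)// ltW.
pose W t : R := - r * n1 t ^+ 2 - QL / 2 * p1 t ^+ 2 + c * k t * (p2 t - x2) ^+ 2
  + dphi t * p1 t ^+ 2 + 2 * phi t * p1 t * (mu * p1 t - r * n1 t)
  - dom t * (p2 t - x2) ^+ 2 + 2 * om t * (p2 t - x2) * h t * p1 t.
have [V [dV VT Vt0E]] : exists V : R -> R, [/\
    forall t, t0 <= t <= T -> is_derive t 1 V (W t),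
    V T = QLT / 2 * p1 T ^+ 2 + phi T * p1 T ^+ 2 &
    V t0 = (c * Kt t0 - om t0) * p2 T ^+ 2].
  exact: (@hamiltonian_energy T r mu QL QLT c t0 h k Kt phi dphi om dom).
(* Completing the square in [om D] costs [h^2 / gam] times [p1^2], at most [H^2 / gam], while the
   inequality on [phi] has [H] to spare; [H < gam] makes the balance positive. *)
pose eps := H - H ^+ 2 / gam.
have gam0 : 0 < gam by lra.
have eps0 : 0 < eps.
  by rewrite /eps subr_gt0 ltr_pdivrMr// expr2 ltr_pM2l.
have WE t : t0 <= t <= T -> W t <= - eps * p1 t ^+ 2.
  move=> tT; have := phiR t tT; have := omR t tT; have := hH t tT.
  rewrite ler_norml => /andP[h1 h2] om1 phi1.
  have h3 : h t ^+ 2 <= H ^+ 2 by nra.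
  have h4 : h t ^+ 2 / gam <= H ^+ 2 / gam by rewrite ler_pM2r ?invr_gt0.
  pose y := p2 t - x2.
  (* Completing the squares in [n1] and in [om D]. *)
  have E1 : W t = - r * (n1 t + phi t * p1 t) ^+ 2
     + (dphi t + r * phi t ^+ 2 + 2 * mu * phi t + H - QL / 2) * p1 t ^+ 2
     - (dom t - (c * k t + gam * om t ^+ 2)) * y ^+ 2
     - gam * (om t * y - h t / gam * p1 t) ^+ 2
     + (h t ^+ 2 / gam - H) * p1 t ^+ 2.
    by rewrite /W /y; field; rewrite gt_eqF.
  have A1 : 0 <= r * (n1 t + phi t * p1 t) ^+ 2 by rewrite mulr_ge0 ?sqr_ge0.
  have A2 : (dphi t + r * phi t ^+ 2 + 2 * mu * phi t + H - QL / 2) * p1 t ^+ 2 <= 0.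
    by rewrite mulr_le0_ge0 ?sqr_ge0.
  have A3 : 0 <= (dom t - (c * k t + gam * om t ^+ 2)) * y ^+ 2.
    by rewrite mulr_ge0 ?sqr_ge0// subr_ge0.
  have A4 : 0 <= gam * (om t * y - h t / gam * p1 t) ^+ 2.
    by rewrite mulr_ge0 ?sqr_ge0// ltW.
  have A5 : (h t ^+ 2 / gam - H) * p1 t ^+ 2 <= - eps * p1 t ^+ 2.
    by rewrite ler_wpM2r ?sqr_ge0// /eps; lra.
  by rewrite E1; lra.
have Vt0 : V t0 <= 0.
  by rewrite Vt0E mulr_le0_ge0 ?sqr_ge0// subr_le0.
have Vdec a b : t0 <= a -> a <= b -> b <= T -> V b <= V a.
  move=> ta ab bT; apply: (@derive_le0_nincr _ V W) => //.
  - apply: is_derive_within => t /andP[at_ tb].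
    by apply: dV; rewrite (le_trans ta)//= (le_trans tb).
  - move=> t /andP[at_ tb].
    by apply: dV; rewrite (le_trans ta (ltW at_))/= (le_trans (ltW tb)).
  - move=> t /andP[at_ tb].
    have tT : t0 <= t <= T by rewrite (le_trans ta (ltW at_))/= (le_trans (ltW tb)).
    apply: (le_trans (WE t tT)).
    by rewrite mulr_le0_ge0 ?sqr_ge0// oppr_le0 ltW.
have VT0 : 0 <= V T.
  by rewrite VT addr_ge0// mulr_ge0 ?sqr_ge0// divr_ge0// ltW.
have V0 t : t0 <= t <= T -> V t = 0.
  move=> /andP[tt0 tT]; have := Vdec t0 t (lexx _) tt0 tT.
  by have := Vdec t T tt0 tT (lexx _); move: Vt0 VT0; lra.
(* [V T] is [p1 T ^+ 2] times [QLT / 2 + phi T], which is positive. *)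
have p1T : p1 T = 0.
  have := V0 T; rewrite t0T lexx => /(_ isT); rewrite VT -mulrDl => /eqP.
  rewrite mulf_eq0 sqrf_eq0 => /orP[/eqP|/eqP//].
  by move: phiT QLT0; lra.
have p1E t : t0 < t < T -> p1 t = 0.
  move=> tT; have /andP[t1 t2] := tT.
  have tT' : t0 <= t <= T by rewrite !ltW.
  (* At an interior point [V] vanishes on a neighbourhood, so its derivative [W t] is 0, and the
     bound by [- eps * p1 t ^+ 2] forces [p1 t = 0]. *)
  have dV0 : is_derive t 1 V 0.
    have Hc : is_derive t 1 (fun=> 0 : R) 0 by exact: is_derive_cst.
    apply: near_eq_is_derive Hc.
    near=> s; rewrite V0//.
    have : s \in `]t0, T[ by near: s; exact: near_in_itvoo.
    by rewrite in_itv/= => /andP[/ltW -> /ltW ->].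
  have W0 : W t = 0 by have [_ <-] := dV t tT'; case: dV0.
  have := WE t tT'; rewrite W0 mulNr oppr_ge0 pmulr_rle0// => p1le.
  by apply/eqP; rewrite -sqrf_eq0 eq_le p1le sqr_ge0.
have const0 (f df : R -> R) (t : R) : (forall s, t0 <= s <= T -> is_derive s 1 f (df s)) ->
    (forall s, t0 < s < T -> df s = 0) -> f t0 = 0 -> t0 <= t <= T -> f t = 0.
  move=> dff df0 ft0 /andP[tt0 tT]; rewrite -ft0; apply/esym; apply: derive0_const => //.
    by apply: is_derive_within => s /andP[s1 s2]; apply: dff; rewrite s1 (le_trans s2).
  move=> s /andP[s1 s2]; rewrite -(df0 s) ?s1 ?(lt_le_trans s2)//.
  by apply: dff; rewrite (ltW s1) (le_trans (ltW s2)).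
have p2E t : t0 <= t <= T -> p2 t = 0.
  apply: const0 dp2 _ p20 => s sT; by rewrite p1E// mulr0.
split => //; first by apply: p2E; rewrite lexx andbT.
apply: const0 dp3 _ p30 _; last by rewrite lexx andbT.
by move=> s /andP[s1 s2]; rewrite p2E ?mulr0// !ltW.
Unshelve. all: by end_near. Qed.

End Lyapunov.

(** * Matrix Riccati equations *)

Section Riccati.
Variables (R : realType) (n : nat) (T : R).
Hypothesis T0 : 0 <= T.
Implicit Types (A Q L X Y : R -> 'M[R]_n) (S : 'M[R]_n).

Lemma linear_ode_mx_unique m (G : R -> 'M[R]_n) (b Z Z' : R -> 'M[R]_(n, m)) :
  {within `[0, T], continuous G} ->
  {within `[0, T], continuous Z} -> {within `[0, T], continuous Z'} ->
  (forall t, 0 < t < T -> is_derive t 1 Z (G t *m Z t + b t)) ->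
  (forall t, 0 < t < T -> is_derive t 1 Z' (G t *m Z' t + b t)) ->
  Z T = Z' T -> forall t, 0 <= t <= T -> Z t = Z' t.
Proof.
move=> cG cZ cZ' dZ dZ' ZT t tT; apply/eqP; rewrite -subr_eq0; apply/eqP.
have [C C0 HC] := within_mx_bounded T0 cG.
apply: (@gronwall_mx _ _ _ (fun t => Z t - Z' t) (fun t => G t *m (Z t - Z' t)) C T) => //.
- exact: within_continuousB.
- move=> s sT; rewrite mulmxBr -[X in X - _](addrK (b s)) -addrA -opprD [b s + _]addrC.
  by apply: is_deriveB; [exact: dZ|exact: dZ'].
- move=> s /andP[s1 s2]; apply: le_trans (mx_l1M _ _) _.
  by rewrite ler_wpM2r ?mx_l1_ge0// HC// !ltW.
- by rewrite ZT subrr.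
Qed.

(** With [D = L - L'], the quadratic terms differ by [D S L + L' S D]. So [D] solves a linear
    equation, whose coefficients are bounded because [A] and both solutions are continuous, and
    Gronwall applies. *)
Lemma riccati_unique A Q L L' S :
  {within `[0, T], continuous A} ->
  {within `[0, T], continuous L} -> {within `[0, T], continuous L'} ->
  (forall t, 0 < t < T -> is_derive t 1 L
     (L t *m S *m L t - L t *m A t - (A t)^T *m L t - Q t)) ->
  (forall t, 0 < t < T -> is_derive t 1 L'
     (L' t *m S *m L' t - L' t *m A t - (A t)^T *m L' t - Q t)) ->
  L T = L' T -> forall t, 0 <= t <= T -> L t = L' t.
Proof.
move=> cA cL cL' dL dL' LT t tT; apply/eqP; rewrite -subr_eq0; apply/eqP.
have [CA CA0 HA] := within_mx_bounded T0 cA.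
have [CL CL0 HL] := within_mx_bounded T0 cL.
have [CL' CL'0 HL'] := within_mx_bounded T0 cL'.
have trE (M : 'M[R]_n) : mx_l1 M^T = mx_l1 M.
  rewrite /mx_l1 exchange_big/=; apply: eq_bigr => i _; apply: eq_bigr => j _.
  by rewrite mxE.
pose C := mx_l1 S * CL + CL' * mx_l1 S + CA + CA.
apply: (@gronwall_mx _ _ _ (fun t => L t - L' t)
  (fun t => (L t - L' t) *m (S *m L t) + L' t *m S *m (L t - L' t)
            - (L t - L' t) *m A t - (A t)^T *m (L t - L' t)) C T) => //.
- by rewrite !addr_ge0 ?mulr_ge0 ?mx_l1_ge0.
- exact: within_continuousB.
- move=> s sT.
  rewrite (_ : _ - _ = (L s *m S *m L s - L s *m A s - (A s)^T *m L s - Q s)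
    - (L' s *m S *m L' s - L' s *m A s - (A s)^T *m L' s - Q s)); last first.
    rewrite !mulmxBl !mulmxBr !mulmxA.
    set a := L s *m S *m L s; set b := L' s *m S *m L s.
    set c := L' s *m S *m L' s; set d := L s *m A s; set e := L' s *m A s.
    set f := (A s)^T *m L s; set g := (A s)^T *m L' s.
    by apply/matrixP => i j; rewrite !mxE; ring.
  by apply: is_deriveB; [exact: dL|exact: dL'].
- move=> s /andP[s1 s2]; have sT : 0 <= s <= T by rewrite !ltW.
  have D0 := mx_l1_ge0 (L s - L' s); have S0 := mx_l1_ge0 S.
  have := HA s sT; have := HL s sT; have := HL' s sT => h1 h2 h3.
  apply: le_trans (mx_l1D _ _) _; rewrite mx_l1N.
  apply: le_trans (lerD (mx_l1D _ _) (lexx _)) _; rewrite mx_l1N.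
  apply: le_trans (lerD (lerD (mx_l1D _ _) (lexx _)) (lexx _)) _.
  have E1 : mx_l1 ((L s - L' s) *m (S *m L s)) <= mx_l1 (L s - L' s) * (mx_l1 S * CL).
    apply: le_trans (mx_l1M _ _) _; rewrite ler_wpM2l//.
    by apply: le_trans (mx_l1M _ _) _; rewrite ler_wpM2l.
  have E2 : mx_l1 (L' s *m S *m (L s - L' s)) <= CL' * mx_l1 S * mx_l1 (L s - L' s).
    apply: le_trans (mx_l1M _ _) _; rewrite ler_wpM2r//.
    by apply: le_trans (mx_l1M _ _) _; rewrite ler_wpM2r.
  have E3 : mx_l1 ((L s - L' s) *m A s) <= mx_l1 (L s - L' s) * CA.
    by apply: le_trans (mx_l1M _ _) _; rewrite ler_wpM2l.
  have E4 : mx_l1 ((A s)^T *m (L s - L' s)) <= CA * mx_l1 (L s - L' s).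
    by apply: le_trans (mx_l1M _ _) _; rewrite trE ler_wpM2r.
  apply: le_trans (lerD (lerD (lerD E1 E2) E3) E4) _.
  by rewrite le_eqVlt /C; apply/orP; left; apply/eqP; ring.
- by rewrite LT subrr.
Qed.

(** [kermx] is the kernel on row vectors, so the hypothesis on column vectors is transferred by
    transposition. *)
Lemma unitmx_of_kernel (M : 'M[R]_n) :
  (forall x : 'cV[R]_n, M *m x = 0 -> x = 0) -> M \in unitmx.
Proof.
move=> kM; rewrite -unitmx_tr -row_free_unit -kermx_eq0.
apply/eqP/row_matrixP => i; rewrite row0 -[LHS]trmxK.
suff -> : (row i (kermx M^T))^T = 0 by rewrite trmx0.
apply: kM; apply: trmx_inj; rewrite trmx_mul trmxK trmx0.
by apply/sub_kermxP; exact: row_sub.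
Qed.

(** Global existence reduces to invertibility of [X]: the pair [(X, Y)], stacked as a [2n] by [n]
    matrix, solves a linear system and so exists on all of [[0, T]]. *)
Lemma riccati_exists A Q S (LT : 'M[R]_n) :
  {within `[0, T], continuous A} -> {within `[0, T], continuous Q} ->
  (forall X Y, X T = 1%:M -> Y T = LT ->
    (forall t, 0 <= t <= T -> is_derive t 1 X (A t *m X t - S *m Y t)) ->
    (forall t, 0 <= t <= T -> is_derive t 1 Y (- (Q t *m X t) - (A t)^T *m Y t)) ->
    forall t, 0 <= t <= T -> X t \in unitmx) ->
  exists L, L T = LT /\ forall t, 0 <= t <= T -> is_derive t 1 L
      (L t *m S *m L t - L t *m A t - (A t)^T *m L t - Q t).
Proof.
move=> cA cQ unitX.
have cG : {within `[0, T], continuous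
    (fun t => block_mx (A t) (- S) (- Q t) (- (A t)^T) : 'M[R]_(n + n))}.
  apply/within_mxP => i j.
  move/within_mxP: cA => cA; move/within_mxP: cQ => cQ.
  case: (split_ordP i) => i' ->; case: (split_ordP j) => j' ->.
  - rewrite (_ : (fun s => _) = fun s => A s i' j'); first exact: cA.
    by apply/funext => s; rewrite block_mxEul.
  - rewrite (_ : (fun s => _) = cst (- S i' j')); first by move=> x; exact: cvg_cst.
    by apply/funext => s; rewrite block_mxEur mxE.
  - rewrite (_ : (fun s => _) = fun s => - Q s i' j').
      by move=> x; apply: cvgN; exact: cQ.
    by apply/funext => s; rewrite block_mxEdl mxE.
  - rewrite (_ : (fun s => _) = fun s => - A s j' i').
      by move=> x; apply: cvgN; exact: cA.
    by apply/funext => s; rewrite block_mxEdr !mxE.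
have cb : {within `[0, T], continuous (fun _ : R => 0 : 'M[R]_(n + n, n))}.
  by move=> x; exact: cvg_cst.
have [Z [ZT dZ]] := linear_ode_mx (col_mx 1%:M LT) T0 cG cb.
pose X t := usubmx (Z t); pose Y t := dsubmx (Z t).
have dZ' t : 0 <= t <= T -> is_derive t 1 Z
    (col_mx (A t *m X t - S *m Y t) (- (Q t *m X t) - (A t)^T *m Y t)).
  move=> tT; have := dZ t tT.
  rewrite addr0 -[Z t]vsubmxK mul_block_col !mulNmx.
  exact.
have dX t : 0 <= t <= T -> is_derive t 1 X (A t *m X t - S *m Y t).
  move=> /dZ'/is_derive_mxP d; apply/is_derive_mxP => i j.
  have := d (lshift n i) j; rewrite col_mxEu.
  rewrite (_ : (fun s => X s i j) = fun s => Z s (lshift n i) j)//.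
  by apply/funext => s; rewrite mxE.
have dY t : 0 <= t <= T -> is_derive t 1 Y (- (Q t *m X t) - (A t)^T *m Y t).
  move=> /dZ'/is_derive_mxP d; apply/is_derive_mxP => i j.
  have := d (rshift n i) j; rewrite col_mxEd.
  rewrite (_ : (fun s => Y s i j) = fun s => Z s (rshift n i) j)//.
  by apply/funext => s; rewrite mxE.
have XT : X T = 1%:M by rewrite /X ZT col_mxKu.
have YT : Y T = LT by rewrite /Y ZT col_mxKd.
have uX := unitX X Y XT YT dX dY.
exists (fun t => Y t *m invmx (X t)); split; first by rewrite XT YT invmx1 mulmx1.
move=> t tT.
apply: (is_derive_eq (is_derive_mulmx (dY t tT) (is_derive_invmx (dX t tT) (uX t tT)))).
set V := invmx (X t); have XV : X t *m V = 1%:M by rewrite mulmxV// uX.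
rewrite mulmxBl mulNmx -!mulmxA XV mulmx1 mulmxN.
rewrite mulmxBl -!mulmxA XV mulmx1 !mulmxBr !mulmxA.
by apply/matrixP => i j; rewrite !mxE; ring.
Qed.

End Riccati.

(** * Barrier functions *)

Section Barriers.
Variable R : realType.
Implicit Types (T t : R).

Lemma supnorm_ge T (f : R -> R) t : {within `[0, T], continuous f} ->
  0 <= t <= T -> `|f t| <= supnorm T f.
Proof.
move=> cf tT; have T0 : 0 <= T by case/andP: tT; exact: le_trans.
have [M _ HM] := within_bounded T0 cf.
apply: ub_le_sup; last by exists t => //=; rewrite in_itv.
by exists M => _ [s /= + <-]; rewrite in_itv => /HM.
Qed.

Lemma within_continuous_eq T (f g : R -> R) :
  (forall t, 0 <= t <= T -> f t = g t) -> {within `[0, T], continuous g} ->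
  {within `[0, T], continuous f}.
Proof.
move=> fg; apply: subspace_eq_continuous => t.
by rewrite inE/= in_itv/= => /fg.
Qed.

Lemma tan_riccati (T b q : R) : 0 < b -> 0 < q -> Num.sqrt (b * q) * T < pi / 2 ->
  exists phi : R -> R, phi T = 0 /\
    forall t, 0 <= t <= T -> is_derive t 1 phi (- (b * phi t ^+ 2 + q)).
Proof.
move=> b0 q0 wT; set w := Num.sqrt (b * q) in wT.
pose s := Num.sqrt (q / b).
have w0 : 0 <= w by exact: sqrtr_ge0.
(* With [s * w = q] and [b * s ^+ 2 = q], the identity [tan' = 1 + tan^2] yields exactly the Riccati
   right-hand side. *)
have sw : s * w = q.
  rewrite /s /w -sqrtrM ?divr_ge0 ?ltW//.
  rewrite (_ : q / b * (b * q) = q ^+ 2); first by rewrite sqrtr_sqr gtr0_norm.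
  by field; rewrite gt_eqF.
have bs : b * s ^+ 2 = q.
  by rewrite /s sqr_sqrtr ?divr_ge0 ?ltW// mulrC divfK// gt_eqF.
exists (fun t => s * tan (w * (T - t))); split.
  by rewrite subrr mulr0 tan0 mulr0.
move=> t /andP[t0 tT].
have c0 : 0 < cos (w * (T - t)).
  apply: cos_gt0_pihalf; apply/andP; split.
    by apply: (@lt_le_trans _ _ 0); rewrite ?oppr_lt0 ?divr_gt0 ?pi_gt0// mulr_ge0// subr_ge0.
  by apply: le_lt_trans wT; rewrite ler_wpM2l// gerBl.
have cN : cos (w * (T - t)) != 0 by rewrite gt_eqF.
have dlin : is_derive t 1 (fun t : R => w * (T - t)) (w * (0 - 1)).
  have dT : is_derive t 1 (fun t : R => T - t) (0 - 1) by exact: is_deriveB.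
  exact: (@is_deriveZ _ _ _ (fun t => T - t) w t 1 _ dT).
have dtan := @is_derive1_comp _ tan (fun t => w * (T - t)) t _ _ (is_derive_tan cN) dlin.
apply: (is_derive_eq (@is_deriveZ _ _ _ (tan \o (fun t => w * (T - t))) s t 1 _ dtan)).
rewrite /GRing.scale/= cos2_tan2//; set y := tan _.
have -> : b * (s * y) ^+ 2 = q * y ^+ 2 by rewrite exprMn mulrA bs.
by transitivity (- (s * w * (1 + y ^+ 2))); [ring|rewrite sw; ring].
Qed.

(** With [v = 1 / (1 - m t)], one has [v' = m v^2], and [v >= 1] on [[0, T]]; the derivative of
    [om = c Kt v] is [c k v + c Kt m v^2]. The first term is at least [c k]; the second dominates
    [gam om^2] because [gam Kt <= H (K + 1)]. *)
Lemma rational_riccati (T c H K : R) (k Kt : R -> R) :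
  0 <= c -> 0 < H -> 0 <= K -> H * c * (K + 1) * T < 1 ->
  (forall t, 0 <= t <= T -> 0 <= k t) ->
  (forall t, 0 <= t <= T -> 0 <= Kt t <= K) ->
  (forall t, 0 <= t <= T -> is_derive t 1 Kt (k t)) ->
  exists gam (om dom : R -> R), [/\ 0 < H < gam,
    forall t, 0 <= t <= T -> is_derive t 1 om (dom t),
    forall t, 0 <= t <= T -> c * k t + gam * om t ^+ 2 <= dom t &
    forall t, 0 <= t <= T -> c * Kt t <= om t].
Proof.
move=> c0 H0 K0 mT k0 KtK dKt; set m := H * c * (K + 1) in mT.
have m0 : 0 <= m by rewrite !mulr_ge0 ?addr_ge0// ltW.
have K12 : 0 < K + 2^-1 by lra.
(* Any [gam] in [(H, H (K + 1) / K]] would do; this one needs no [K > 0]. *)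
pose gam := H * (K + 1) / (K + 2^-1).
have u0 t : 0 <= t <= T -> 0 < 1 - m * t <= 1.
  move=> /andP[t0 tT]; rewrite subr_gt0 gerBl mulr_ge0// andbT.
  by apply: le_lt_trans mT; rewrite ler_wpM2l.
pose v t := (1 - m * t)^-1.
have v1 t : 0 <= t <= T -> 1 <= v t.
  by move=> /u0/andP[? ?]; rewrite /v invf_ge1.
exists gam, (fun t => c * (Kt t * v t)),
  (fun t => c * (k t * v t + Kt t * (m * v t ^+ 2))); split.
- rewrite H0 /= /gam ltr_pdivlMr//; rewrite ltr_pM2l//; lra.
- move=> t tT; have /andP[ut _] := u0 t tT.
  have dl : is_derive t 1 (fun t : R => 1 - m * t) (0 - m * 1).
    have d1 : is_derive t 1 (fun t : R => m * t) (m * 1).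
      exact: (@is_deriveZ _ _ _ id m t 1 1).
    exact: is_deriveB.
  have uN : 1 - m * t != 0 by rewrite gt_eqF.
  have dv := @is_deriveV _ (fun t : R => 1 - m * t) t _ 1 uN dl.
  apply: (is_derive_eq (@is_deriveZ _ _ _ _ c t 1 _ (is_deriveM (dKt t tT) dv))).
  rewrite /GRing.scale/= /v exprVn; ring.
- move=> t tT; have vt := v1 t tT; have kt := k0 t tT.
  have /andP[Kt0 KtK'] := KtK t tT.
  have A1 : c * k t <= c * (k t * v t) by rewrite ler_wpM2l// ler_peMr.
  have A2 : gam * (c * (Kt t * v t)) ^+ 2 <= c * (Kt t * (m * v t ^+ 2)).
    have -> : gam * (c * (Kt t * v t)) ^+ 2 = c * Kt t * v t ^+ 2 * (c * (gam * Kt t)) by ring.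
    have -> : c * (Kt t * (m * v t ^+ 2)) = c * Kt t * v t ^+ 2 * (c * (H * (K + 1))).
      by rewrite /m; ring.
    apply: ler_wpM2l; first by rewrite mulr_ge0 ?sqr_ge0// mulr_ge0.
    apply: ler_wpM2l => //; rewrite /gam mulrAC ler_pdivrMr//.
    apply: ler_wpM2l; first by rewrite mulr_ge0 ?(ltW H0)// addr_ge0.
    by lra.
  by rewrite mulrDr; exact: lerD.
- move=> t tT; have /andP[Kt0 _] := KtK t tT.
  by rewrite ler_wpM2l// ler_peMr// v1.
Qed.

Lemma atan_le (x : R) : 0 <= x -> atan x <= x.
Proof.
move=> x0; rewrite -subr_le0 -[X in _ <= X](subrr 0) -{1}atan0.
have df (t : R) : is_derive t 1 (fun t => atan t - t) ((1 + t ^+ 2)^-1 - 1).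
  by apply: is_deriveB.
apply: (@derive_le0_nincr _ (fun t => atan t - t)
  (fun t => (1 + t ^+ 2)^-1 - 1) 0 x x0).
- by apply: is_derive_within => t _; exact: df.
- move=> t _; rewrite subr_le0 invf_le1; last by rewrite ltr_pwDl ?sqr_ge0.
  by rewrite lerDl sqr_ge0.
Qed.

End Barriers.

(** * The leader system *)

Section LeaderSystem.
Variable R : realType.
Implicit Types (T t : R) (h k F : R -> R).

(** Explicit ordinals, on which the list lookups in [mx3] compute. *)
Let i0 : 'I_3 := @Ordinal 3 0 isT.
Let i1 : 'I_3 := @Ordinal 3 1 isT.
Let i2 : 'I_3 := @Ordinal 3 2 isT.

Let sum3 (f : 'I_3 -> R) : \sum_j f j = f i0 + f i1 + f i2.
Proof.
rewrite !big_ord_recl big_ord0 addr0 addrA.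
by congr (f _ + f _ + f _); apply: val_inj.
Qed.

Let cases3 (P : 'I_3 -> Prop) : P i0 -> P i1 -> P i2 -> forall i, P i.
Proof.
move=> P0 P1 P2 [[|[|[|//]]] lt3].
- by rewrite (_ : Ordinal lt3 = i0)//; apply: val_inj.
- by rewrite (_ : Ordinal lt3 = i1)//; apply: val_inj.
- by rewrite (_ : Ordinal lt3 = i2)//; apply: val_inj.
Qed.

Definition gain (BL RL : R) : 'M[R]_3 := (2 / RL) *: (calB BL *m (calB BL)^T).

Lemma gainE BL RL : gain BL RL = mx3 (2 / RL * BL ^+ 2) 0 0 0 0 0 0 0 0.
Proof.
apply/matrixP; apply: cases3; apply: cases3;
  rewrite !mxE big_ord_recl big_ord0 !mxE /=; ring.
Qed.

Lemma trmx_mx3 (a11 a12 a13 a21 a22 a23 a31 a32 a33 : R) :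
  (mx3 a11 a12 a13 a21 a22 a23 a31 a32 a33)^T =
  mx3 a11 a21 a31 a12 a22 a32 a13 a23 a33.
Proof. by apply/matrixP; apply: cases3; apply: cases3; rewrite !mxE. Qed.

Lemma mulmx3E (a11 a12 a13 a21 a22 a23 a31 a32 a33 : R) (x : 'cV[R]_3) :
  let y := mx3 a11 a12 a13 a21 a22 a23 a31 a32 a33 *m x in
  [/\ y i0 0 = a11 * x i0 0 + a12 * x i1 0 + a13 * x i2 0,
      y i1 0 = a21 * x i0 0 + a22 * x i1 0 + a23 * x i2 0 &
      y i2 0 = a31 * x i0 0 + a32 * x i1 0 + a33 * x i2 0].
Proof. by move=> y; rewrite /y !mxE !sum3 !mxE. Qed.

Lemma within_mx3 (A : set R) (f11 f12 f13 f21 f22 f23 f31 f32 f33 : R -> R) :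
  [/\ {within A, continuous f11}, {within A, continuous f12} & {within A, continuous f13}] ->
  [/\ {within A, continuous f21}, {within A, continuous f22} & {within A, continuous f23}] ->
  [/\ {within A, continuous f31}, {within A, continuous f32} & {within A, continuous f33}] ->
  {within A, continuous (fun t => mx3 (f11 t) (f12 t) (f13 t) (f21 t) (f22 t) (f23 t)
    (f31 t) (f32 t) (f33 t))}.
Proof.
move=> [c11 c12 c13] [c21 c22 c23] [c31 c32 c33]; apply/within_mxP.
have eqf (f g : R -> R) : {within A, continuous f} -> g = f -> {within A, continuous g}.
  by move=> + ->.
apply: cases3; apply: cases3;
  [apply: (eqf _ _ c11)|apply: (eqf _ _ c12)|apply: (eqf _ _ c13)
  |apply: (eqf _ _ c21)|apply: (eqf _ _ c22)|apply: (eqf _ _ c23)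
  |apply: (eqf _ _ c31)|apply: (eqf _ _ c32)|apply: (eqf _ _ c33)];
  by apply/funext => t; rewrite mxE.
Qed.

Lemma within_cst (A : set R) (x : R) : {within A, continuous (fun _ : R => x)}.
Proof. by move=> y; exact: cvg_cst. Qed.

(** A kernel vector [x] of [X t0] gives a solution [X x], [Y x] of the scalar Hamiltonian equations
    whose first half vanishes at [t0]; [hamiltonian_kernel_trivial] then makes [X T x = x]
    vanish. *)
Lemma hamiltonian_unitmx (T AL BL QL RL QLT c H gam : R)
    (h k Kt phi dphi om dom : R -> R) (X Y : R -> 'M[R]_3) :
  0 < RL -> 0 < QLT -> 0 < H < gam ->
  (forall t, 0 <= t <= T -> `|h t| <= H) ->
  (forall t, 0 <= t <= T -> is_derive t 1 Kt (k t)) ->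
  (forall t, 0 <= t <= T -> is_derive t 1 phi (dphi t)) ->
  (forall t, 0 <= t <= T -> is_derive t 1 om (dom t)) ->
  (forall t, 0 <= t <= T ->
     dphi t + 2 / RL * BL ^+ 2 * phi t ^+ 2 + 2 * AL * phi t + H - QL / 2 <= 0) ->
  (forall t, 0 <= t <= T -> c * k t + gam * om t ^+ 2 <= dom t) ->
  0 <= phi T -> (forall t, 0 <= t <= T -> c * Kt t <= om t) ->
  Kt T = intl k 0 T ->
  X T = 1%:M -> Y T = LTmx QLT c T k ->
  (forall t, 0 <= t <= T ->
     is_derive t 1 X (calA AL h k t *m X t - gain BL RL *m Y t)) ->
  (forall t, 0 <= t <= T ->
     is_derive t 1 Y (- (calQ QL c k t *m X t) - (calA AL h k t)^T *m Y t)) ->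
  forall t, 0 <= t <= T -> X t \in unitmx.
Proof.
move=> RL0 QLT0 Hg hH dKt dphi' dom' phiR omR phiT omK KtT XT YT dX dY t0 /andP[t00 t0T].
apply: unitmx_of_kernel => x X0.
pose p t := X t *m x; pose e t := Y t *m x.
have inT t : t0 <= t <= T -> 0 <= t <= T by move=> /andP[a b]; rewrite b (le_trans t00).
have dp t : t0 <= t <= T -> is_derive t 1 p (calA AL h k t *m p t - gain BL RL *m e t).
  move=> /inT/dX/(is_derive_mulmx_cst x).
  by rewrite mulmxBl -!mulmxA.
have de t : t0 <= t <= T ->
    is_derive t 1 e (- (calQ QL c k t *m p t) - (calA AL h k t)^T *m e t).
  move=> /inT/dY/(is_derive_mulmx_cst x).
  by rewrite mulmxBl mulNmx -!mulmxA.
have pT : p T = x by rewrite /p XT mul1mx.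
have eT : e T = LTmx QLT c T k *m p T by rewrite pT /e YT.
have [eT0 eT1 eT2] := mulmx3E (QLT / 2) 0 0 0 (- c * intl k 0 T) c 0 c 0 (p T).
rewrite -/(LTmx QLT c T k) -eT in eT0 eT1 eT2.
have r0 : 0 <= 2 / RL * BL ^+ 2 by rewrite mulr_ge0 ?sqr_ge0// divr_ge0// ltW.
have dpe i t (y : R) : t0 <= t <= T ->
    (calA AL h k t *m p t - gain BL RL *m e t) i 0 = y ->
    is_derive t 1 (fun s => p s i 0) y.
  by move=> tT <-; have /is_derive_mxP := dp t tT; apply.
have dee i t (y : R) : t0 <= t <= T ->
    (- (calQ QL c k t *m p t) - (calA AL h k t)^T *m e t) i 0 = y ->
    is_derive t 1 (fun s => e s i 0) y.
  by move=> tT <-; have /is_derive_mxP := de t tT; apply.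
have mxBE (u v : 'cV[R]_3) i : (u - v) i 0 = u i 0 - v i 0 by rewrite !mxE.
have mxNE (u : 'cV[R]_3) i : (- u) i 0 = - u i 0 by rewrite !mxE.
have [||||||||||||||||||||p0 p1 p2] := @hamiltonian_kernel_trivial R T (2 / RL * BL ^+ 2)
  AL QL QLT c H gam t0 h k Kt phi dphi om dom (fun s => p s i0 0) (fun s => p s i1 0)
  (fun s => p s i2 0) (fun s => e s i0 0) (fun s => e s i1 0) (fun s => e s i2 0)
  r0 QLT0 Hg t0T.
- by move=> t /inT; exact: hH.
- by move=> t /inT; exact: dKt.
- by move=> t /inT; exact: dphi'.
- by move=> t /inT; exact: dom'.
- by move=> t /inT; exact: phiR.
- by move=> t /inT; exact: omR.
- exact: phiT.
- by apply: omK; rewrite t00.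
- move=> t tT; apply: dpe => //; rewrite mxBE gainE /calA.
  have [-> _ _] := mulmx3E AL 0 0 (- h t) 0 0 0 (k t) 0 (p t).
  have [-> _ _] := mulmx3E (2 / RL * BL ^+ 2) 0 0 0 0 0 0 0 0 (e t).
  by ring.
- move=> t tT; apply: dpe => //; rewrite mxBE gainE /calA.
  have [_ -> _] := mulmx3E AL 0 0 (- h t) 0 0 0 (k t) 0 (p t).
  have [_ -> _] := mulmx3E (2 / RL * BL ^+ 2) 0 0 0 0 0 0 0 0 (e t).
  by ring.
- move=> t tT; apply: dpe => //; rewrite mxBE gainE /calA.
  have [_ _ ->] := mulmx3E AL 0 0 (- h t) 0 0 0 (k t) 0 (p t).
  have [_ _ ->] := mulmx3E (2 / RL * BL ^+ 2) 0 0 0 0 0 0 0 0 (e t).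
  by ring.
- move=> t tT; apply: dee => //; rewrite mxBE mxNE /calA trmx_mx3 /calQ.
  have [-> _ _] := mulmx3E (QL / 2) 0 0 0 (- c * k t) 0 0 0 0 (p t).
  have [-> _ _] := mulmx3E AL (- h t) 0 0 0 (k t) 0 0 0 (e t).
  by ring.
- move=> t tT; apply: dee => //; rewrite mxBE mxNE /calA trmx_mx3 /calQ.
  have [_ -> _] := mulmx3E (QL / 2) 0 0 0 (- c * k t) 0 0 0 0 (p t).
  have [_ -> _] := mulmx3E AL (- h t) 0 0 0 (k t) 0 0 0 (e t).
  by ring.
- move=> t tT; apply: dee => //; rewrite mxBE mxNE /calA trmx_mx3 /calQ.
  have [_ _ ->] := mulmx3E (QL / 2) 0 0 0 (- c * k t) 0 0 0 0 (p t).
  have [_ _ ->] := mulmx3E AL (- h t) 0 0 0 (k t) 0 0 0 (e t).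
  by ring.
- by rewrite eT0; ring.
- by rewrite eT1 KtT; ring.
- by rewrite eT2; ring.
- by rewrite /p X0 mxE.
- by rewrite /p X0 mxE.
- by rewrite /p X0 mxE.
apply/matrixP => i j; rewrite (ord1 j) [RHS]mxE -pT.
by move: i; exact: cases3.
Qed.

End LeaderSystem.

(** * Existence and uniqueness for the pair [(L, M)], from the Riccati and linear equations *)

Section System.
Variable R : realType.
Implicit Types (T t : R) (h k F : R -> R).

Lemma ode_sol_derive (V : normedModType R) T (x : R -> V) (E : R -> V -> V -> Prop) t :
  ode_sol T x E -> 0 < t < T -> exists2 d, is_derive t 1 x d & E t (x t) d.
Proof.
move=> [_ H] /H[d e]; exists (derive1 x t) => //.
by rewrite derive1E; exact/derivableP.
Qed.

Lemma derive_ode_sol (V : normedModType R) T (x : R -> V) (E : R -> V -> V -> Prop)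
    (d : R -> V) :
  {within `[0, T], continuous x} ->
  (forall t, 0 < t < T -> is_derive t 1 x (d t)) ->
  (forall t, 0 < t < T -> E t (x t) (d t)) -> ode_sol T x E.
Proof.
move=> cx dx Ex; split=> // t tT; have [dxt de] := dx t tT.
by split=> //; rewrite derive1E de; exact: Ex.
Qed.

Lemma is_derive_trmx m n (M : R -> 'M[R]_(m, n)) dM t :
  is_derive t 1 M dM -> is_derive t 1 (fun s => (M s)^T) dM^T.
Proof.
move=> /is_derive_mxP H; apply/is_derive_mxP => i j; rewrite mxE.
by rewrite (_ : (fun _ => _) = fun s => M s j i)//; apply/funext => s; rewrite mxE.
Qed.

Lemma gain_mul BL RL m (L : 'M[R]_3) (Y : 'M[R]_(3, m)) :
  (2 / RL) *: (L *m calB BL *m (calB BL)^T *m Y) = L *m gain BL RL *m Y.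
Proof. by rewrite /gain; move: (calB BL) => B; rewrite -scalemxAr -scalemxAl mulmxA. Qed.

Lemma system_sol_derive T AL BL QL RL QLT c F h k L M t :
  system_sol T AL BL QL RL QLT c F h k L M -> 0 < t < T ->
  is_derive t 1 L (L t *m gain BL RL *m L t - L t *m calA AL h k t
     - (calA AL h k t)^T *m L t - calQ QL c k t) /\
  is_derive t 1 M ((L t *m gain BL RL - (calA AL h k t)^T) *m M t
     + (QL * F t) *: e1 R).
Proof.
move=> [_ [solL [solM _]]] tT; split.
- have [d dL] := ode_sol_derive solL tT; rewrite gain_mul => E.
  apply: (is_derive_eq dL).
  apply/eqP; rewrite -subr_eq0 -[X in _ == X]E; apply/eqP.
  by apply/matrixP => i j; rewrite !mxE; ring.
- have [d dM] := ode_sol_derive solM tT; rewrite gain_mul => E.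
  apply: (is_derive_eq dM).
  apply/eqP; rewrite -subr_eq0 -[X in _ == X]E mulmxBl; apply/eqP.
  by apply/matrixP => i j; rewrite !mxE; ring.
Qed.

Lemma within_calA (A : set R) AL h k : {within A, continuous h} ->
  {within A, continuous k} -> {within A, continuous (calA AL h k)}.
Proof.
move=> ch ck; apply: within_mx3; split; do ?exact: within_cst; last exact: ck.
by move=> x; apply: cvgN; exact: ch.
Qed.

Lemma within_calQ (A : set R) QL c k : {within A, continuous k} ->
  {within A, continuous (calQ QL c k)}.
Proof.
move=> ck; apply: within_mx3; split; do ?exact: within_cst.
by move=> x; apply: cvgM; [exact: cvg_cst|exact: ck].
Qed.

Lemma within_feedback (A : set R) (L B : R -> 'M[R]_3) S :
  {within A, continuous L} -> {within A, continuous B} ->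
  {within A, continuous (fun t => L t *m S - (B t)^T)}.
Proof.
move=> /within_mxP cL /within_mxP cB; apply/within_mxP => i j.
rewrite (_ : (fun _ => _) = (fun s => \sum_k L s i k * S k j - B s j i)); last first.
  by apply/funext => s; rewrite !mxE.
move=> x; apply: cvgB; last exact: cB.
by apply: cvg_sumr => l; apply: cvgM; [exact: cL|exact: cvg_cst].
Qed.

(** The Riccati equation does not involve [M], so it determines [L] first; [M] and [M'] then solve
    one and the same linear equation. *)
Lemma system_unique T AL BL QL RL QLT c F h k L M L' M' : 0 <= T ->
  {within `[0, T], continuous h} -> {within `[0, T], continuous k} ->
  system_sol T AL BL QL RL QLT c F h k L M ->
  system_sol T AL BL QL RL QLT c F h k L' M' ->
  forall t, 0 <= t <= T -> L t = L' t /\ M t = M' t.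
Proof.
move=> T0 ch ck sol sol'.
have dLM := system_sol_derive sol; have dLM' := system_sol_derive sol'.
move: sol sol' => [_ [[cL _] [[cM _] [LT MT]]]] [_ [[cL' _] [[cM' _] [LT' MT']]]].
have cA := @within_calA _ AL h k ch ck.
have LL : forall t, 0 <= t <= T -> L t = L' t.
  apply: (riccati_unique T0 cA cL cL' (fun t tT => (dLM t tT).1)
    (fun t tT => (dLM' t tT).1)).
  by rewrite LT LT'.
have cG := @within_feedback _ L _ (gain BL RL) cL cA.
have MM : forall t, 0 <= t <= T -> M t = M' t.
  apply: (linear_ode_mx_unique T0 cG cM cM' (fun t tT => (dLM t tT).2)).
    move=> t tT; have /andP[t0 t1] := tT.
    by rewrite LL ?(ltW t0) ?(ltW t1)//; exact: (dLM' t tT).2.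
  by rewrite MT MT'.
by move=> t tT; rewrite LL// MM.
Qed.

Lemma system_exists T AL BL QL RL QLT c F h k (L : R -> 'M[R]_3) : 0 <= T ->
  {within `[0, T], continuous h} -> {within `[0, T], continuous k} ->
  {within `[0, T], continuous F} ->
  L T = LTmx QLT c T k ->
  (forall t, 0 <= t <= T -> is_derive t 1 L (L t *m gain BL RL *m L t
     - L t *m calA AL h k t - (calA AL h k t)^T *m L t - calQ QL c k t)) ->
  exists L M, system_sol T AL BL QL RL QLT c F h k L M.
Proof.
move=> T0 ch ck cF LT dL.
have cA := @within_calA _ AL h k ch ck.
have cL : {within `[0, T], continuous L}.
  by apply/within_mxP => i j; apply: is_derive_within => t /dL /is_derive_mxP; exact.
have cG := @within_feedback _ L _ (gain BL RL) cL cA.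
have cb : {within `[0, T], continuous (fun t => (QL * F t) *: e1 R)}.
  apply/within_mxP => i j.
  rewrite (_ : (fun _ => _) = fun s => QL * F s * e1 R i j); last first.
    by apply/funext => s; rewrite mxE.
  move=> x; apply: cvgM; last exact: cvg_cst.
  by apply: cvgM; [exact: cvg_cst|exact: cF].
have [M [MT dM]] := linear_ode_mx (MTvec QLT F T) T0 cG cb.
have inT t : 0 < t < T -> 0 <= t <= T by move=> /andP[a b]; rewrite !ltW.
exists L, M; split; [|split; [|split; [|split]]] => //.
(* Symmetry comes from uniqueness: transposition exchanges the two linear terms, so [L^T] solves the
   same Riccati equation, with the same symmetric terminal value. *)
- suff LE : forall t, 0 <= t <= T -> L t = (L t)^T by move=> t /LE.
  have cLt : {within `[0, T], continuous (fun t => (L t)^T)}.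
    apply/within_mxP => i j; move/within_mxP: cL => /(_ j i).
    by rewrite (_ : (fun s => (L s)^T i j) = fun s => L s j i)//;
      apply/funext => s; rewrite mxE.
  apply: (riccati_unique T0 cA cL cLt (fun t tT => dL t (inT t tT))); last first.
    by rewrite LT /LTmx trmx_mx3.
  move=> t tT; apply: (is_derive_eq (is_derive_trmx (dL t (inT t tT)))).
  rewrite !linearB/= !trmx_mul !trmxK gainE /calQ !trmx_mx3 mulmxA.
  by congr (_ - _); rewrite -!addrA; congr (_ + _); rewrite addrC.
- apply: derive_ode_sol cL (fun t tT => dL t (inT t tT)) _ => t tT.
  rewrite gain_mul.
  by apply/matrixP => i j; rewrite !mxE; ring.
- apply: (derive_ode_sol _ (fun t tT => dM t (inT t tT))) => [|t tT].
    by apply/within_mxP => i j; apply: is_derive_within => t /dM /is_derive_mxP; exact.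
  rewrite gain_mul mulmxBl.
  by apply/matrixP => i j; rewrite !mxE; ring.
Qed.

End System.

(** * Consequences of the bound on [T], and regularity of the coefficients [h] and [k] *)

Section Conditions.
Variable R : realType.

(** The arctangent is bounded in two ways, by [pi / 2] and by its argument. In the second,
    [sqrt (b q) = b sqrt (q / b)] lets the factor [sqrt (q / b)] cancel. *)
Lemma smallness_consequences (T b q y : R) : 0 < b -> 0 < q -> 0 < y ->
  T < 1 / Num.sqrt (b * q) * atan (Num.sqrt (q / b) * (1 / y)) ->
  Num.sqrt (b * q) * T < pi / 2 /\ b * y * T < 1.
Proof.
move=> b0 q0 y0 HT.
have w0 : 0 < Num.sqrt (b * q) by rewrite sqrtr_gt0 mulr_gt0.
have s0 : 0 < Num.sqrt (q / b) by rewrite sqrtr_gt0 divr_gt0.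
have wbs : Num.sqrt (b * q) = b * Num.sqrt (q / b).
  rewrite -{2}(gtr0_norm b0) -sqrtr_sqr -sqrtrM ?sqr_ge0//; congr Num.sqrt.
  by field; rewrite gt_eqF.
have {}HT : Num.sqrt (b * q) * T < atan (Num.sqrt (q / b) * (1 / y)).
  by move: HT; rewrite mul1r mulrC ltr_pdivlMr// mulrC.
split; first by apply: lt_trans HT _; exact: atan_ltpi2.
have z0 : 0 <= Num.sqrt (q / b) * (1 / y) by rewrite mulr_ge0 ?divr_ge0// ltW.
have := lt_le_trans HT (atan_le z0).
rewrite wbs mul1r ltr_pdivlMr// => H.
rewrite -(ltr_pM2r s0) mul1r; apply: le_lt_trans H.
by rewrite le_eqVlt; apply/orP; left; apply/eqP; ring.
Qed.

(** The estimate [2 AL phi <= |AL| (1 + phi^2)] splits the linear term between the coefficient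
    [r + |AL| <= b] of [phi^2] and the constant [H - QL / 2 + |AL| <= q], so a solution of
    [phi' = - (b phi^2 + q)] satisfies the inequality. *)
Lemma riccati_barrier (T AL r QL H b q : R) : 0 < b -> 0 < q ->
  r + `|AL| <= b -> `|QL / 2 - `|AL| - H| <= q -> Num.sqrt (b * q) * T < pi / 2 ->
  exists phi dphi : R -> R, [/\
    forall t, 0 <= t <= T -> is_derive t 1 phi (dphi t),
    forall t, 0 <= t <= T ->
      dphi t + r * phi t ^+ 2 + 2 * AL * phi t + H - QL / 2 <= 0 &
    0 <= phi T].
Proof.
move=> b0 q0 rb Hq wT; have [QLH|QLH] := leP H (QL / 2).
  (* If [H <= QL / 2], the inequality already holds for the zero function. *)
  exists (fun=> 0), (fun=> 0); split=> // t _; first exact: is_derive_cst.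
  by rewrite expr0n/= !mulr0 !addr0 add0r subr_le0.
have [phi [phiT dphi]] := tan_riccati b0 q0 wT.
exists phi, (fun t => - (b * phi t ^+ 2 + q)); split=> // [t _|]; last by rewrite phiT.
have {}Hq : H - QL / 2 + `|AL| <= q by move: Hq; rewrite ler_norml => /andP[]; lra.
have A : 2 * AL * phi t <= `|AL| * (1 + phi t ^+ 2).
  have A0 := normr_ge0 AL; have := sqr_ge0 (1 - phi t); have := sqr_ge0 (1 + phi t).
  case: (ger0P AL) A0 => _ A0 s1 s2; nra.
have B : (r + `|AL|) * phi t ^+ 2 <= b * phi t ^+ 2 by rewrite ler_wpM2r ?sqr_ge0.
nra.
Qed.

Lemma kF_gt0 AF BF RF (a : R -> R) t : 0 < kF AF BF RF a t.
Proof. exact: expR_gt0. Qed.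

Lemma hF_gt0 AF BF RF QF (a : R -> R) t : 0 < QF -> 0 < hF AF BF RF QF a t.
Proof. by move=> Q0; rewrite mulr_gt0 ?expR_gt0. Qed.

Lemma within_intl (T : R) (f : R -> R) : {within `[0, T], continuous f} ->
  {within `[0, T], continuous (fun t => intl f 0 t)}.
Proof.
move=> cf; have [T0|T0] := leP 0 T; last first.
  by rewrite set_itv_ge ?bnd_simp -?ltNge//; exact: continuous_subspace0.
apply: within_continuous_eq (fun t tT => intlE cf tT) _.
have cc := continuous_comp_clamp T0 cf.
move=> x; apply: cvgB; last exact: cvg_cst.
have c : {within `[0, T], continuous (prim (f \o clamp T))}.
  apply: is_derive_within => t /andP[t0 _].
  by apply: (is_derive_prim cc); lra.
exact: c.
Qed.

Lemma within_fF AF BF RF (A : set R) (a : R -> R) : {within A, continuous a} ->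
  {within A, continuous (fF AF BF RF a)}.
Proof.
move=> ca x; apply: cvgB; first exact: cvg_cst.
by apply: cvgM; [exact: cvg_cst|exact: ca].
Qed.

Lemma within_hF (T AF BF RF QF : R) (a : R -> R) : {within `[0, T], continuous a} ->
  {within `[0, T], continuous (hF AF BF RF QF a)}.
Proof.
move=> /(@within_fF AF BF RF)/within_intl ci x; apply: cvgM; first exact: cvg_cst.
by apply: (@cvg_comp _ _ _ _ expR) (ci x) _; exact: continuous_expR.
Qed.

Lemma within_kF (T AF BF RF : R) (a : R -> R) : {within `[0, T], continuous a} ->
  {within `[0, T], continuous (kF AF BF RF a)}.
Proof.
move=> /(@within_fF AF BF RF)/within_intl ci.
have c2 : {within `[0, T], continuous (fun t => - 2 * intl (fF AF BF RF a) 0 t)}.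
  by move=> x; apply: cvgM; [exact: cvg_cst|exact: ci].
by move=> x; apply: (@cvg_comp _ _ _ _ expR) (c2 x) _; exact: continuous_expR.
Qed.

End Conditions.

(** * Assembly: both barriers from the bound on [T], then [L], then [M] *)

Theorem theorem3p4 (R : realType) (T AF BF AL BL sigF sigL QF RF QL RL QLT lamL : R)
  (F a : R -> R) :
  0 < T -> BF != 0 ->
  0 < sigF -> 0 < sigL -> 0 < QF -> 0 < RF -> 0 < QL -> 0 < RL -> 0 < QLT ->
  0 <= lamL ->
  {within `[0, T], continuous F} ->
  (* a solves the scalar Riccati equation on [0,T] with a_T = 0 *)
  ode_sol T a (fun t x dx => dx = 2 * BF ^+ 2 / RF * x ^+ 2 - 2 * AF * x - QF / 2) ->
  a T = 0 ->
  let h := hF AF BF RF QF a in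
  let k := kF AF BF RF a in
  let c := cstc BF sigF RF lamL in
  let q := Num.max `|QL / 2 - `|AL| - supnorm T h| ((c + 1) * supnorm T k) in
  let beta := Num.max (Num.max (2 / RL * BL ^+ 2 + `|AL|) (supnorm T h)) (supnorm T k) in
  let y0 := Num.max (QLT / 2) (c * (L1norm T k + 1)) in
  T < 1 / Num.sqrt (beta * q) * atan (Num.sqrt (q / beta) * (1 / y0)) ->
  (exists L M, system_sol T AL BL QL RL QLT c F h k L M) /\
  (forall L M L' M', system_sol T AL BL QL RL QLT c F h k L M ->
     system_sol T AL BL QL RL QLT c F h k L' M' ->
     forall t, 0 <= t <= T -> L t = L' t /\ M t = M' t).
Proof.
move=> T0 _ sigF0 _ QF0 RF0 _ RL0 QLT0 lamL0 cF [ca _] _ h k c q beta y0 HT.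
have T0' := ltW T0.
have ch : {within `[0, T], continuous h} by exact: within_hF.
have ck : {within `[0, T], continuous k} by exact: within_kF.
split; last by move=> L M L' M'; exact: system_unique.
have k0 t : 0 < k t by exact: kF_gt0.
have h0 t : 0 < h t by exact: hF_gt0.
have c0 : 0 <= c.
  have B4 : 0 <= BF ^+ 4 by rewrite exprn_even_ge0.
  by apply: divr_ge0; apply: mulr_ge0 => //; exact: sqr_ge0.
have in0 : 0 <= (0 : R) <= T by rewrite lexx.
set H := supnorm T h in q beta HT.
have H0 : 0 < H.
  by apply: lt_le_trans (supnorm_ge ch in0); rewrite gtr0_norm.
have ks0 : 0 < supnorm T k.
  by apply: lt_le_trans (supnorm_ge ck in0); rewrite gtr0_norm.
have q0 : 0 < q.
  (* The second entry of the maximum is positive, since [0 <= c] and the sup norm of [k] is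
     positive. *)
  by rewrite /q lt_max; apply/orP; right; rewrite mulr_gt0// ltr_wpDl.
have beta0 : 0 < beta by rewrite /beta !lt_max ks0 !orbT.
have y00 : 0 < y0 by rewrite /y0 lt_max divr_gt0.
have [wT byT] := smallness_consequences beta0 q0 y00 HT.
have ckc := continuous_comp_clamp T0' ck.
(* Equal on [[0, T]] to the integral of [k] from 0; being built from the clamped [k], it has a
   two-sided derivative at both endpoints. *)
pose Kt t := prim (k \o clamp T) t - prim (k \o clamp T) 0.
have dKt t : 0 <= t <= T -> is_derive t 1 Kt (k t).
  move=> tT; have <- : (k \o clamp T) t - 0 = k t by rewrite subr0 /= clampE.
  apply: is_deriveB; apply: (is_derive_prim ckc).
  by case/andP: tT; lra.
have KtE t : 0 <= t <= T -> Kt t = intl k 0 t by move=> tT; rewrite (intlE ck tT).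
have KtT : Kt T = intl k 0 T by rewrite KtE// lexx T0'.
have Kt_le s t : 0 <= s -> s <= t -> t <= T -> Kt s <= Kt t.
  move=> s0 st tT; rewrite -lerN2.
  apply: (@derive_le0_nincr _ (fun x => - Kt x) (fun x => - k x)) => //.
  - move=> x; apply: cvgN; have cK : {within `[s, t], continuous Kt}.
      apply: is_derive_within => u /andP[su ut].
      by apply: dKt; rewrite (le_trans s0)//= (le_trans ut).
    exact: cK.
  - move=> u /andP[su ut]; apply: is_deriveN; apply: dKt.
    by rewrite (le_trans s0 (ltW su))//= (le_trans (ltW ut)).
  - by move=> u _; rewrite oppr_le0 ltW.
have Kt0 : Kt 0 = 0 by rewrite /Kt subrr.
have KtB t : 0 <= t <= T -> 0 <= Kt t <= Kt T.
  by move=> /andP[t0 tT]; rewrite -{1}Kt0 !Kt_le.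
have K0 : 0 <= Kt T by rewrite -{1}Kt0 Kt_le.
have y0K : c * (Kt T + 1) <= y0.
  (* [k] is positive, so its integral is its norm in [L^1]; this links [Kt T] to [y0]. *)
  have -> : Kt T = L1norm T k.
    rewrite KtT /L1norm; congr intl; apply/funext => t.
    by rewrite gtr0_norm.
  by rewrite /y0 le_max lexx orbT.
have Hb : H <= beta by rewrite /beta !le_max lexx !orbT.
(* [H <= beta] and [c * (Kt T + 1) <= y0] bound the left side by [beta * y0 * T]. *)
have mT : H * c * (Kt T + 1) * T < 1.
  apply: le_lt_trans byT; rewrite ler_wpM2r//.
  by rewrite -mulrA ler_pM// ?(ltW H0)// mulr_ge0// addr_ge0.
have [gam [om [dom [Hg dom' omR omK]]]] := rational_riccati c0 H0 K0 mT
  (fun t _ => ltW (k0 t)) KtB dKt.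
have rb : 2 / RL * BL ^+ 2 + `|AL| <= beta by rewrite /beta !le_max lexx.
have Hq : `|QL / 2 - `|AL| - H| <= q by rewrite /q le_max lexx.
have [phi [dphi [dphi' phiR phiT]]] := riccati_barrier beta0 q0 rb Hq wT.
have [L [LT dL]] : exists L, L T = LTmx QLT c T k /\ forall t, 0 <= t <= T ->
    is_derive t 1 L (L t *m gain BL RL *m L t - L t *m calA AL h k t
      - (calA AL h k t)^T *m L t - calQ QL c k t).
  apply: (@riccati_exists R 3 T T0' (calA AL h k) (calQ QL c k) (gain BL RL)
    (LTmx QLT c T k) (@within_calA R _ AL h k ch ck) (@within_calQ R _ QL c k ck)).
  move=> X Y XT YT dX dY; apply: (hamiltonian_unitmx RL0 QLT0 Hg _ dKt dphi' dom'
    phiR omR phiT omK KtT XT YT dX dY).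
  by move=> t tT; exact: supnorm_ge.
exact: (system_exists T0' ch ck cF LT dL).
Qed.
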